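(* Let $\Lambda$ be a row-finite $k$-graph without sources, and let $R$ be a commutative ring with $1\neq0$. Then $\mathrm{KP}_R(\Lambda)$ is basically simple if and only if $\Lambda$ is cofinal and aperiodic.
   Context: Conventions: $\mathbb{N}$ includes $0$, and $k$ is a positive integer. For $m,n\in\mathbb{N}^k$, $m\le n$ is coordinatewise and $m\vee n$ is the coordinatewise maximum. Rings and $R$-algebras are associative but not assumed to have an identity; ideals are two-sided. A $k$-graph is a countable category $\Lambda$ (with object set $\Lambda^0$, set of morphisms also written $\Lambda$, domain map $s$, codomain map $r$; $\lambda\mu$ is defined when $s(\lambda)=r(\mu)$) together with a functor $d:\Lambda\to\mathbb{N}^k$ (where $\mathbb{N}^k$ is viewed as a category with one object) with the factorization property: if $d(\lambda)=m+n$ there are unique $\mu,\nu\in\Lambda$ with $d(\mu)=m$, $d(\nu)=n$, $\lambda=\mu\nu$. Objects are identified with identity morphisms, so $\Lambda^0=d^{-1}(0)$. Write $\Lambda^n=d^{-1}(n)$, $v\Lambda=\{\lambda\in\Lambda:r(\lambda)=v\}$, $v\Lambda^n=v\Lambda\cap\Lambda^n$ and $v\Lambda w=\{\lambda\in v\Lambda:s(\lambda)=w\}$. $\Lambda$ is row-finite if every $v\Lambda^n$ ($v\in\Lambda^0$, $n\in\mathbb{N}^k$) is finite, and has no sources if every $v\Lambda^n$ is nonempty. For $\lambda\in\Lambda$ and $0\le m\le n\le d(\lambda)$, write $\lambda=\lambda'\lambda''\lambda'''$ uniquely with $d(\lambda')=m$, $d(\lambda'')=n-m$, $d(\lambda''')=d(\lambda)-n$,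 and put $\lambda(m,n):=\lambda''$. $\Lambda$ is aperiodic if for every $v\in\Lambda^0$ and all $m\neq n$ in $\mathbb{N}^k$ there is $\lambda\in v\Lambda$ with $d(\lambda)\ge m\vee n$ and $\lambda(m,m+d(\lambda)-(m\vee n))\neq\lambda(n,n+d(\lambda)-(m\vee n))$. Let $\Omega_k$ be the $k$-graph with objects $\mathbb{N}^k$, morphisms $(p,q)$ with $p\le q$ in $\mathbb{N}^k$, $r(p,q)=p$, $s(p,q)=q$, $(p,q)(q,t)=(p,t)$, $d(p,q)=q-p$. An infinite path in $\Lambda$ is a degree-preserving functor $x:\Omega_k\to\Lambda$; write $x(n)$ for the vertex $x(n,n)$ and $\Lambda^\infty$ for the set of infinite paths. $\Lambda$ is cofinal if for every $x\in\Lambda^\infty$ and $v\in\Lambda^0$ there is $n\in\mathbb{N}^k$ with $v\Lambda x(n)\neq\emptyset$. Let $\Lambda^{\neq0}=\{\lambda\in\Lambda:d(\lambda)\neq0\}$. For each $\lambda\in\Lambda^{\neq0}$ introduce a formal symbol $\lambda^*$ (ghost path), and let $G(\Lambda^{\neq0})=\{\lambda^*:\lambda\in\Lambda^{\neq0}\}$. A Kumjian-Pask $\Lambda$-family $(P,S)$ in an $R$-algebra $A$ consists of functions $P:\Lambda^0\to A$ and $S:\Lambda^{\neq0}\cup G(\Lambda^{\neq0})\to A$ such that: (KP1) $\{P_v:v\in\Lambda^0\}$ is a family of mutually orthogonal idempotents; (KP2) for all $\lambda,\mu\in\Lambda^{\neq0}$ with $r(\mu)=s(\lambda)$: $S_\lambda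 S_\mu=S_{\lambda\mu}$, $S_{\mu^*}S_{\lambda^*}=S_{(\lambda\mu)^*}$, $P_{r(\lambda)}S_\lambda=S_\lambda=S_\lambda P_{s(\lambda)}$, $P_{s(\lambda)}S_{\lambda^*}=S_{\lambda^*}=S_{\lambda^*}P_{r(\lambda)}$; (KP3) for all $\lambda,\mu\in\Lambda^{\neq0}$ with $d(\lambda)=d(\mu)$: $S_{\lambda^*}S_\mu=\delta_{\lambda,\mu}P_{s(\lambda)}$; (KP4) for all $v\in\Lambda^0$ and $n\in\mathbb{N}^k\setminus\{0\}$: $P_v=\sum_{\lambda\in v\Lambda^n}S_\lambda S_{\lambda^*}$. The Kumjian-Pask algebra $\mathrm{KP}_R(\Lambda)$ is the $R$-algebra generated by a universal Kumjian-Pask $\Lambda$-family $(p,s)$ (the free $R$-algebra on $\Lambda^0\cup\Lambda^{\neq0}\cup G(\Lambda^{\neq0})$ modulo the relations (KP1)-(KP4)). An ideal $I$ of $\mathrm{KP}_R(\Lambda)$ is basic if $rp_v\in I$ with $v\in\Lambda^0$ and $r\in R\setminus\{0\}$ implies $p_v\in I$. $\mathrm{KP}_R(\Lambda)$ is basically simple if its only basic ideals are $\{0\}$ and $\mathrm{KP}_R(\Lambda)$. *)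

(* Defs.v *)
From HB Require Import structures.
From mathcomp Require Import all_boot all_order all_algebra.
From mathcomp Require Import boolp classical_sets cardinality.

Set Implicit Arguments.
Unset Strict Implicit.
Unset Printing Implicit Defensive.

Import GRing.Theory.
Local Open Scope ring_scope.
Local Open Scope classical_set_scope.
Local Open Scope quotient_scope.

(* Addition and 0 on N^k are the pointwise ones of {ffun}. *)
Notation deg k := {ffun 'I_k -> nat}.

Definition deg_le k (m n : deg k) : bool := [forall i, (m i <= n i)%N].
Definition deg_max k (m n : deg k) : deg k := [ffun i => maxn (m i) (n i)].
(* Truncated; only used where deg_le n m holds. *)
Definition deg_sub k (m n : deg k) : deg k := [ffun i => (m i - n i)%N].

Lemma deg_subK k (m n : deg k) : deg_le m n -> m + deg_sub n m = n.
Proof. by move=> /forallP h; apply/ffunP => i; rewrite !ffunE; apply: subnKC. Qed.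

(* A small category with its degree functor.  Composition is a total function
   whose value [kcomp l m] is meaningful only when [ks l = kr m]; every axiom is
   restricted to that case. Morphisms compose as in [l m : s(m) -> r(l)]. *)
Record kgraph (k : nat) := KGraph {
  kobj : countType;
  kmor : countType;
  kid : kobj -> kmor;
  kr : kmor -> kobj;
  ks : kmor -> kobj;
  kcomp : kmor -> kmor -> kmor;
  kd : kmor -> deg k;
  kr_id : forall v, kr (kid v) = v;
  ks_id : forall v, ks (kid v) = v;
  kr_comp : forall l m, ks l = kr m -> kr (kcomp l m) = kr l;
  ks_comp : forall l m, ks l = kr m -> ks (kcomp l m) = ks m;
  kcomp_idl : forall l, kcomp (kid (kr l)) l = l;
  kcomp_idr : forall l, kcomp l (kid (ks l)) = l;
  kcompA : forall l m n, ks l = kr m -> ks m = kr n ->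
    kcomp l (kcomp m n) = kcomp (kcomp l m) n;
  kd_id : forall v, kd (kid v) = 0;
  kd_comp : forall l m, ks l = kr m -> kd (kcomp l m) = kd l + kd m;
  kfactor : forall l m n, kd l = m + n ->
    exists! ab : kmor * kmor,
      [/\ kd ab.1 = m, kd ab.2 = n, ks ab.1 = kr ab.2 & l = kcomp ab.1 ab.2]
}.

Section KGraphs.
Context {k : nat}.
Implicit Type L : kgraph k.

Definition paths_from L (v : kobj L) (n : deg k) : set (kmor L) :=
  [set l | kr l = v /\ kd l = n].

Definition row_finite L : Prop :=
  forall (v : kobj L) (n : deg k), finite_set (paths_from v n).

Definition no_sources L : Prop :=
  forall (v : kobj L) (n : deg k), paths_from v n !=set0.

(* The segment l(m,n), for m <= n <= d(l); by the factorization property it is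
   then the only element of the set below (see [segmentE]). *)
Definition segment L (l : kmor L) (m n : deg k) : kmor L :=
  xget l [set b | exists a c : kmor L,
    [/\ kd a = m, kd b = deg_sub n m & kd c = deg_sub (kd l) n] /\
    [/\ ks a = kr b, ks b = kr c & l = kcomp a (kcomp b c)]].

Definition aperiodic L : Prop :=
  forall (v : kobj L) (m n : deg k), m <> n ->
  exists l : kmor L,
    [/\ kr l = v,
        deg_le (deg_max m n) (kd l) &
        segment l m (m + deg_sub (kd l) (deg_max m n)) <>
        segment l n (n + deg_sub (kd l) (deg_max m n))].

Lemma segmentE L (a b c : kmor L) : ks a = kr b -> ks b = kr c ->
  segment (kcomp a (kcomp b c)) (kd a) (kd a + kd b) = b.
Proof.
move=> ab bc; have abc : ks a = kr (kcomp b c) by rewrite kr_comp.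
have e1 : deg_sub (kd a + kd b) (kd a) = kd b.
  by apply/ffunP => i; rewrite !ffunE; apply: addKn.
have e2 : deg_sub (kd (kcomp a (kcomp b c))) (kd a + kd b) = kd c.
  by apply/ffunP => i; rewrite kd_comp// kd_comp// addrA !ffunE; apply: addKn.
apply: xget_unique; first by exists a, c; rewrite e1 e2.
move=> b' [a' [c' []]]; rewrite e1 e2 => -[da db dc] [ab' bc' E].
have abc' : ks a' = kr (kcomp b' c') by rewrite kr_comp.
have := @kfactor _ L (kcomp a (kcomp b c)) (kd a) (kd (kcomp b c)) (kd_comp abc).
case=> p [_ pU].
have := pU (a, kcomp b c); have := pU (a', kcomp b' c').
rewrite -{}E => -> /=; last by split => //; rewrite !kd_comp// db dc.
move=> /(_ (And4 erefl erefl abc erefl))[_ E].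
have [q [_ qU]] := @kfactor _ L (kcomp b c) (kd b) (kd c) (kd_comp bc).
have := qU (b, c); have := qU (b', c'); rewrite -{}E => -> //=.
by move=> /(_ (And4 erefl erefl bc erefl))[].
Qed.

End KGraphs.

Record kgraph_hom k (L M : kgraph k) := KGraphHom {
  kh_obj :> kobj L -> kobj M;
  kh_mor : kmor L -> kmor M;
  kh_id : forall v, kh_mor (kid v) = kid (kh_obj v);
  kh_r : forall l, kr (kh_mor l) = kh_obj (kr l);
  kh_s : forall l, ks (kh_mor l) = kh_obj (ks l);
  kh_comp : forall l m, ks l = kr m ->
    kh_mor (kcomp l m) = kcomp (kh_mor l) (kh_mor m);
  kh_d : forall l, kd (kh_mor l) = kd l
}.

Section Omega.
Context {k : nat}.

Definition omega_mor := {pq : deg k * deg k | deg_le pq.1 pq.2}.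
HB.instance Definition _ := Countable.on omega_mor.

Implicit Types (l m n : omega_mor) (p : deg k).

Lemma deg_lexx p : deg_le p p.
Proof. by apply/forallP => i. Qed.

Lemma deg_le_trans p q t : deg_le p q -> deg_le q t -> @deg_le k p t.
Proof.
by move=> /forallP pq /forallP qt; apply/forallP => i; apply: leq_trans (qt i).
Qed.

Definition omega_r l : deg k := (val l).1.
Definition omega_s l : deg k := (val l).2.
Definition omega_id p : omega_mor := exist _ (p, p) (deg_lexx p).
(* (p,q)(q,t) = (p,t); the default value l is used only if not composable. *)
Definition omega_comp l m : omega_mor := insubd l (omega_r l, omega_s m).
Definition omega_d l : deg k := deg_sub (omega_s l) (omega_r l).

Lemma val_omega_comp l m : omega_s l = omega_r m ->
  val (omega_comp l m) = (omega_r l, omega_s m).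
Proof.
move=> e; rewrite val_insubd /=; case: ifP => // /negP[].
by apply: (deg_le_trans (valP l)); have := valP m; rewrite -[(val m).1]e.
Qed.

Lemma omega_inj l m : omega_r l = omega_r m -> omega_s l = omega_s m -> l = m.
Proof.
rewrite /omega_r /omega_s => r s; apply: val_inj.
by rewrite (surjective_pairing (val l)) r s -surjective_pairing.
Qed.

Lemma omega_r_comp l m : omega_s l = omega_r m ->
  omega_r (omega_comp l m) = omega_r l.
Proof. by move=> e; rewrite {1}/omega_r val_omega_comp. Qed.

Lemma omega_s_comp l m : omega_s l = omega_r m ->
  omega_s (omega_comp l m) = omega_s m.
Proof. by move=> e; rewrite {1}/omega_s val_omega_comp. Qed.

Lemma omega_comp_idl l : omega_comp (omega_id (omega_r l)) l = l.
Proof. by apply: omega_inj; rewrite ?omega_r_comp ?omega_s_comp. Qed.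

Lemma omega_comp_idr l : omega_comp l (omega_id (omega_s l)) = l.
Proof. by apply: omega_inj; rewrite ?omega_r_comp ?omega_s_comp. Qed.

Lemma omega_compA l m n : omega_s l = omega_r m -> omega_s m = omega_r n ->
  omega_comp l (omega_comp m n) = omega_comp (omega_comp l m) n.
Proof.
move=> lm mn; have [r s] := (omega_r_comp mn, omega_s_comp lm).
by apply: omega_inj; rewrite !(omega_r_comp, omega_s_comp) ?r ?s.
Qed.

Lemma omega_d_id p : omega_d (omega_id p) = 0.
Proof. by apply/ffunP => i; rewrite !ffunE; apply: subnn. Qed.

Lemma omega_dE l : omega_s l = omega_r l + omega_d l.
Proof. by rewrite deg_subK//; apply: (valP l). Qed.

Lemma deg_addI (p : deg k) : injective (+%R p).
Proof.
move=> q t /ffunP e; apply/ffunP => i; have := e i.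
by rewrite !ffunE => /addnI.
Qed.

Lemma omega_d_comp l m : omega_s l = omega_r m ->
  omega_d (omega_comp l m) = omega_d l + omega_d m.
Proof.
move=> e; apply: (@deg_addI (omega_r (omega_comp l m))).
by rewrite -omega_dE omega_r_comp// omega_s_comp// addrA -omega_dE e -omega_dE.
Qed.

Lemma omega_factor l p q : omega_d l = p + q ->
  exists! ab : omega_mor * omega_mor,
    [/\ omega_d ab.1 = p, omega_d ab.2 = q, omega_s ab.1 = omega_r ab.2
      & l = omega_comp ab.1 ab.2].
Proof.
move=> e; have sl : omega_s l = omega_r l + p + q by rewrite omega_dE e addrA.
have h1 : deg_le (omega_r l) (omega_r l + p).
  by apply/forallP => i; rewrite !ffunE leq_addr.
have h2 : deg_le (omega_r l + p) (omega_s l).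
  by apply/forallP => i; rewrite sl !ffunE leq_addr.
pose a : omega_mor := exist _ (omega_r l, omega_r l + p) h1.
pose b : omega_mor := exist _ (omega_r l + p, omega_s l) h2.
have ab : omega_s a = omega_r b by [].
exists (a, b); split => /=.
  split => //; last by apply: omega_inj; rewrite ?omega_r_comp ?omega_s_comp.
  - by apply: (@deg_addI (omega_r a)); rewrite -omega_dE.
  - by apply: (@deg_addI (omega_r b)); rewrite -omega_dE -sl.
case=> a' b' /= [da db s' l'].
have ra : omega_r a' = omega_r l by rewrite l' omega_r_comp.
have sa : omega_s a' = omega_r l + p by rewrite omega_dE ra da.
have sb : omega_s b' = omega_s l by rewrite l' omega_s_comp.
by congr (_, _); apply: omega_inj => //; rewrite -s' sa.
Qed.

Definition Omega : kgraph k :=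
  @KGraph k (deg k) omega_mor omega_id omega_r omega_s omega_comp omega_d
    (fun=> erefl) (fun=> erefl) omega_r_comp omega_s_comp
    omega_comp_idl omega_comp_idr omega_compA omega_d_id omega_d_comp
    omega_factor.

End Omega.
Arguments Omega k : clear implicits.

Definition infinite_path k (L : kgraph k) := kgraph_hom (Omega k) L.

Definition cofinal k (L : kgraph k) : Prop :=
  forall (x : infinite_path L) (v : kobj L), exists n : deg k,
  exists l : kmor L, kr l = v /\ ks l = x n.

Record nualg (R : comNzRingType) := NUAlg {
  nucar :> lmodType R;
  numul : nucar -> nucar -> nucar;
  numulA : associative numul;
  numulDl : left_distributive numul +%R;
  numulDr : right_distributive numul +%R;
  nuscaleAl : forall (c : R) x y, c *: numul x y = numul (c *: x) y;
  nuscaleAr : forall (c : R) x y, c *: numul x y = numul x (c *: y)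
}.

(* Ideals of an R-algebra: two-sided and closed under scalars. (In an algebra
   with local units, such as a Kumjian-Pask algebra, the closure under scalars
   is automatic.) *)
Definition nuideal (R : comNzRingType) (A : nualg R) (I : set A) : Prop :=
  [/\ I 0,
      forall x y, I x -> I y -> I (x + y),
      forall (c : R) x, I x -> I (c *: x) &
      forall a x, I x -> I (numul a x) /\ I (numul x a)].

Section KumjianPask.
Context {k : nat} (R : comNzRingType) (L : kgraph k).

Definition npath := {l : kmor L | kd l != 0}.

(* [e] enumerates v L^n without repetition (n being nonzero). *)
Definition enumerates (e : seq npath) (v : kobj L) (n : deg k) : Prop :=
  uniq e /\ forall l : npath, l \in e <-> paths_from v n (val l).

(* A family (P, S) is given by P, the restriction S of S to paths, and its
   restriction G to ghost paths. *)
Record KP_family (A : nualg R)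
    (P : kobj L -> A) (S : npath -> A) (G : npath -> A) : Prop := {
  KP1 : forall v w, numul (P v) (P w) = if v == w then P v else 0;
  KP2 : forall l m : npath, kr (val m) = ks (val l) ->
    [/\ forall n : npath, val n = kcomp (val l) (val m) ->
          numul (S l) (S m) = S n /\ numul (G m) (G l) = G n,
        numul (P (kr (val l))) (S l) = S l,
        numul (S l) (P (ks (val l))) = S l,
        numul (P (ks (val l))) (G l) = G l &
        numul (G l) (P (kr (val l))) = G l];
  KP3 : forall l m : npath, kd (val l) = kd (val m) ->
    numul (G l) (S m) = if l == m then P (ks (val l)) else 0;
  KP4 : forall (v : kobj L) (n : deg k) (e : seq npath),
    n != 0 -> enumerates e v n ->
    P v = \sum_(l <- e) numul (S l) (G l)
}.

(* The non-unital R-algebra presented by the generators L^0, L^{<>0},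
   G(L^{<>0}) and the relations (KP1)-(KP4): formal expressions in the
   generators modulo the least congruence containing the axioms of
   R-algebras and the relations.  [KP_familyP] and [KP_universal] below state
   that the result carries the universal Kumjian-Pask family. *)
Inductive kpterm : Type :=
| TP of kobj L
| TS of npath
| TG of npath
| T0
| TOpp of kpterm
| TAdd of kpterm & kpterm
| TScale of R & kpterm
| TMul of kpterm & kpterm.

Definition tsum (e : seq npath) : kpterm :=
  foldr (fun l t => TAdd (TMul (TS l) (TG l)) t) T0 e.

Inductive kpcong : kpterm -> kpterm -> Prop :=
| kc_refl t : kpcong t t
| kc_sym t u : kpcong t u -> kpcong u t
| kc_trans t u w : kpcong t u -> kpcong u w -> kpcong t w
| kc_opp t t' : kpcong t t' -> kpcong (TOpp t) (TOpp t')
| kc_add t t' u u' : kpcong t t' -> kpcong u u' ->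
    kpcong (TAdd t u) (TAdd t' u')
| kc_scale c t t' : kpcong t t' -> kpcong (TScale c t) (TScale c t')
| kc_mul t t' u u' : kpcong t t' -> kpcong u u' ->
    kpcong (TMul t u) (TMul t' u')
| kc_addA t u w : kpcong (TAdd t (TAdd u w)) (TAdd (TAdd t u) w)
| kc_addC t u : kpcong (TAdd t u) (TAdd u t)
| kc_add0 t : kpcong (TAdd T0 t) t
| kc_addN t : kpcong (TAdd (TOpp t) t) T0
| kc_scaleA c c' t : kpcong (TScale c (TScale c' t)) (TScale (c * c') t)
| kc_scale1 t : kpcong (TScale 1 t) t
| kc_scaleDr c t u :
    kpcong (TScale c (TAdd t u)) (TAdd (TScale c t) (TScale c u))
| kc_scaleDl c c' t :
    kpcong (TScale (c + c') t) (TAdd (TScale c t) (TScale c' t))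
| kc_mulA t u w : kpcong (TMul t (TMul u w)) (TMul (TMul t u) w)
| kc_mulDl t u w : kpcong (TMul (TAdd t u) w) (TAdd (TMul t w) (TMul u w))
| kc_mulDr t u w : kpcong (TMul t (TAdd u w)) (TAdd (TMul t u) (TMul t w))
| kc_scaleAl c t u : kpcong (TScale c (TMul t u)) (TMul (TScale c t) u)
| kc_scaleAr c t u : kpcong (TScale c (TMul t u)) (TMul t (TScale c u))
| kc_KP1 v w : kpcong (TMul (TP v) (TP w)) (if v == w then TP v else T0)
| kc_KP2_SS (l m n : npath) : kr (val m) = ks (val l) ->
    val n = kcomp (val l) (val m) -> kpcong (TMul (TS l) (TS m)) (TS n)
| kc_KP2_GG (l m n : npath) : kr (val m) = ks (val l) ->
    val n = kcomp (val l) (val m) -> kpcong (TMul (TG m) (TG l)) (TG n)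
| kc_KP2_PS (l m : npath) : kr (val m) = ks (val l) ->
    kpcong (TMul (TP (kr (val l))) (TS l)) (TS l)
| kc_KP2_SP (l m : npath) : kr (val m) = ks (val l) ->
    kpcong (TMul (TS l) (TP (ks (val l)))) (TS l)
| kc_KP2_PG (l m : npath) : kr (val m) = ks (val l) ->
    kpcong (TMul (TP (ks (val l))) (TG l)) (TG l)
| kc_KP2_GP (l m : npath) : kr (val m) = ks (val l) ->
    kpcong (TMul (TG l) (TP (kr (val l)))) (TG l)
| kc_KP3 (l m : npath) : kd (val l) = kd (val m) ->
    kpcong (TMul (TG l) (TS m)) (if l == m then TP (ks (val l)) else T0)
| kc_KP4 (v : kobj L) (n : deg k) (e : seq npath) : n != 0 ->
    enumerates e v n -> kpcong (TP v) (tsum e).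

HB.instance Definition _ := gen_eqMixin kpterm.
HB.instance Definition _ := gen_choiceMixin kpterm.

Definition kpcongb (t u : kpterm) : bool := `[< kpcong t u >].

Lemma kpcongb_refl : reflexive kpcongb.
Proof. by move=> t; apply/asboolP; apply: kc_refl. Qed.

Lemma kpcongb_sym : symmetric kpcongb.
Proof. by move=> t u; apply/asboolP/asboolP; apply: kc_sym. Qed.

Lemma kpcongb_trans : transitive kpcongb.
Proof.
by move=> u t w /asboolP tu /asboolP uw; apply/asboolP; apply: kc_trans uw.
Qed.

Canonical kpcongb_equiv := EquivRel kpcongb kpcongb_refl kpcongb_sym kpcongb_trans.

Definition kpcar := {eq_quot kpcongb}.
HB.instance Definition _ := Choice.on kpcar.

Definition kpi (t : kpterm) : kpcar := \pi_kpcar t.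

Lemma kpiP t u : kpcong t u <-> kpi t = kpi u.
Proof.
split=> [tu|/eqmodP/asboolP//]; apply/eqmodP; exact/asboolP.
Qed.

Lemma kpi_repr (x : kpcar) : kpi (repr x) = x.
Proof. exact: reprK. Qed.

Lemma repr_kpi t : kpcong (repr (kpi t)) t.
Proof. by apply/kpiP; rewrite kpi_repr. Qed.

Lemma kpi_ind (Q : kpcar -> Prop) : (forall t, Q (kpi t)) -> forall x, Q x.
Proof. by move=> h x; rewrite -(kpi_repr x). Qed.

Definition kpopp (x : kpcar) : kpcar := kpi (TOpp (repr x)).
Definition kpadd (x y : kpcar) : kpcar := kpi (TAdd (repr x) (repr y)).
Definition kpscale (c : R) (x : kpcar) : kpcar := kpi (TScale c (repr x)).
Definition kpmul (x y : kpcar) : kpcar := kpi (TMul (repr x) (repr y)).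

Lemma kpi_opp t : kpopp (kpi t) = kpi (TOpp t).
Proof. by apply/kpiP/kc_opp/repr_kpi. Qed.
Lemma kpi_add t u : kpadd (kpi t) (kpi u) = kpi (TAdd t u).
Proof. by apply/kpiP; apply: kc_add; apply: repr_kpi. Qed.
Lemma kpi_scale c t : kpscale c (kpi t) = kpi (TScale c t).
Proof. by apply/kpiP/kc_scale/repr_kpi. Qed.
Lemma kpi_mul t u : kpmul (kpi t) (kpi u) = kpi (TMul t u).
Proof. by apply/kpiP; apply: kc_mul; apply: repr_kpi. Qed.

Let kpE := (kpi_opp, kpi_add, kpi_scale, kpi_mul).

Lemma kpaddA : associative kpadd.
Proof.
elim/kpi_ind=> t; elim/kpi_ind=> u; elim/kpi_ind=> w; rewrite !kpE.
exact/kpiP/kc_addA.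
Qed.
Lemma kpaddC : commutative kpadd.
Proof. elim/kpi_ind=> t; elim/kpi_ind=> u; rewrite !kpE; exact/kpiP/kc_addC. Qed.
Lemma kpadd0 : left_id (kpi T0) kpadd.
Proof. elim/kpi_ind=> t; rewrite !kpE; exact/kpiP/kc_add0. Qed.
Lemma kpaddN : left_inverse (kpi T0) kpopp kpadd.
Proof. elim/kpi_ind=> t; rewrite !kpE; exact/kpiP/kc_addN. Qed.

HB.instance Definition _ := GRing.isZmodule.Build kpcar kpaddA kpaddC kpadd0 kpaddN.

Lemma kpscaleA c c' x : kpscale c (kpscale c' x) = kpscale (c * c') x.
Proof. elim/kpi_ind: x => t; rewrite !kpE; exact/kpiP/kc_scaleA. Qed.
Lemma kpscale1 : left_id 1 kpscale.
Proof. elim/kpi_ind=> t; rewrite !kpE; exact/kpiP/kc_scale1. Qed.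
Lemma kpscaleDr : right_distributive kpscale +%R.
Proof.
move=> c; elim/kpi_ind=> t; elim/kpi_ind=> u; rewrite /+%R/= !kpE.
exact/kpiP/kc_scaleDr.
Qed.
Lemma kpscaleDl x : {morph kpscale^~ x : c c' / c + c'}.
Proof.
elim/kpi_ind: x => t c c'; rewrite !kpE [RHS]kpi_add; exact/kpiP/kc_scaleDl.
Qed.

HB.instance Definition _ := GRing.Zmodule_isLmodule.Build R kpcar
  kpscaleA kpscale1 kpscaleDr kpscaleDl.

Lemma kpmulA : associative kpmul.
Proof.
elim/kpi_ind=> t; elim/kpi_ind=> u; elim/kpi_ind=> w; rewrite !kpE.
exact/kpiP/kc_mulA.
Qed.
Lemma kpmulDl : left_distributive kpmul +%R.
Proof.
elim/kpi_ind=> t; elim/kpi_ind=> u; elim/kpi_ind=> w; rewrite /+%R/= !kpE.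
exact/kpiP/kc_mulDl.
Qed.
Lemma kpmulDr : right_distributive kpmul +%R.
Proof.
elim/kpi_ind=> t; elim/kpi_ind=> u; elim/kpi_ind=> w; rewrite /+%R/= !kpE.
exact/kpiP/kc_mulDr.
Qed.
Lemma kpscaleAl (c : R) (x y : kpcar) : c *: kpmul x y = kpmul (c *: x) y.
Proof.
elim/kpi_ind: x => t; elim/kpi_ind: y => u; rewrite /GRing.scale/= !kpE.
exact/kpiP/kc_scaleAl.
Qed.
Lemma kpscaleAr (c : R) (x y : kpcar) : c *: kpmul x y = kpmul x (c *: y).
Proof.
elim/kpi_ind: x => t; elim/kpi_ind: y => u; rewrite /GRing.scale/= !kpE.
exact/kpiP/kc_scaleAr.
Qed.

Definition KP : nualg R :=
  @NUAlg R kpcar kpmul kpmulA kpmulDl kpmulDr kpscaleAl kpscaleAr.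

Definition kp_p (v : kobj L) : KP := kpi (TP v).
Definition kp_s (l : npath) : KP := kpi (TS l).
Definition kp_g (l : npath) : KP := kpi (TG l).

Lemma KP_familyP : @KP_family KP kp_p kp_s kp_g.
Proof.
split.
- move=> v w; rewrite [LHS]kpi_mul (proj1 (kpiP _ _) (kc_KP1 v w)).
  by case: ifP.
- move=> l m lm; split.
  + move=> n nE; split; rewrite [LHS]kpi_mul; apply/kpiP.
      exact: kc_KP2_SS nE.
    exact: kc_KP2_GG nE.
  + rewrite [LHS]kpi_mul; exact/kpiP/kc_KP2_PS/lm.
  + rewrite [LHS]kpi_mul; exact/kpiP/kc_KP2_SP/lm.
  + rewrite [LHS]kpi_mul; exact/kpiP/kc_KP2_PG/lm.
  + rewrite [LHS]kpi_mul; exact/kpiP/kc_KP2_GP/lm.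
- move=> l m lm; rewrite [LHS]kpi_mul (proj1 (kpiP _ _) (kc_KP3 lm)).
  by case: ifP.
- move=> v n e n0 en; rewrite [LHS](proj1 (kpiP _ _) (kc_KP4 n0 en)).
  elim: e {n0 en} => [|l e IH]; first by rewrite big_nil.
  rewrite big_cons -IH [X in _ = X + _]kpi_mul; exact/esym/kpi_add.
Qed.

Section Universal.
Variables (A : nualg R) (P : kobj L -> A) (S G : npath -> A).

Fixpoint teval (t : kpterm) : A :=
  match t with
  | TP v => P v
  | TS l => S l
  | TG l => G l
  | T0 => 0
  | TOpp t => - teval t
  | TAdd t u => teval t + teval u
  | TScale c t => c *: teval t
  | TMul t u => numul (teval t) (teval u)
  end.

Hypothesis fam : KP_family P S G.

Lemma teval_cong t u : kpcong t u -> teval t = teval u.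
Proof.
elim=> /=; try by move=> *; congruence.
all: try by move=> *; rewrite ?(addrA, add0r, addNr, scalerA, scale1r, scalerDr,
  scalerDl, numulDl, numulDr, numulA, nuscaleAl).
- by move=> *; rewrite addrC.
- by move=> *; rewrite nuscaleAr.
- by move=> v w; rewrite (KP1 fam); case: ifP.
- by move=> l m n lm nE; have [/(_ n nE)[]] := KP2 fam lm.
- by move=> l m n lm nE; have [/(_ n nE)[]] := KP2 fam lm.
- by move=> l m lm; have [] := KP2 fam lm.
- by move=> l m lm; have [] := KP2 fam lm.
- by move=> l m lm; have [] := KP2 fam lm.
- by move=> l m lm; have [] := KP2 fam lm.
- by move=> l m lm; rewrite (KP3 fam lm); case: ifP.
- move=> v n e n0 en; rewrite (KP4 fam n0 en).
  by elim: e {n0 en} => [|l e IH]; rewrite ?big_nil ?big_cons /= ?IH.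
Qed.

Lemma KP_universal : exists! f : KP -> A,
  [/\ forall (c : R) x y, f (c *: x + y) = c *: f x + f y,
      forall x y, f (numul x y) = numul (f x) (f y) &
      [/\ forall v, f (kp_p v) = P v, forall l, f (kp_s l) = S l &
          forall l, f (kp_g l) = G l]].
Proof.
have ev t : teval (repr (kpi t)) = teval t by apply: teval_cong; apply: repr_kpi.
exists (fun x : KP => teval (repr (x : kpcar))); split.
  split; last by split => ?; apply: ev.
  - by move=> c x y; rewrite /GRing.scale/= /kpscale /+%R/= /kpadd ev /= ev.
  - by move=> x y; rewrite /= ev.
move=> f [fL fM [fP fS fG]]; apply/funext; elim/kpi_ind => t; rewrite ev.
have f0 : f 0 = 0.
  by have := fL (-1) 0 0; rewrite !scaleN1r !addNr.
have fD x y : f (x + y) = f x + f y by rewrite -[x]scale1r fL !scale1r.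
have fZ (c : R) x : f (c *: x) = c *: f x by rewrite -[c *: x]addr0 fL f0 addr0.
elim: t => /= [v|l|l||t IH|t IHt u IHu|c t IH|t IHt u IHu].
- exact/esym/fP.
- exact/esym/fS.
- exact/esym/fG.
- exact/esym/f0.
- have -> : kpi (TOpp t) = -1 *: (kpi t : KP).
    by rewrite scaleN1r; apply/esym/kpi_opp.
  by rewrite (fZ (-1) (kpi t : KP)) scaleN1r IH.
- have -> : kpi (TAdd t u) = (kpi t : KP) + (kpi u : KP) by apply/esym/kpi_add.
  by rewrite (fD (kpi t : KP)) IHt IHu.
- have -> : kpi (TScale c t) = c *: (kpi t : KP) by apply/esym/kpi_scale.
  by rewrite (fZ c (kpi t : KP)) IH.
- have -> : kpi (TMul t u) = numul (kpi t : KP) (kpi u : KP).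
    exact/esym/kpi_mul.
  by rewrite (fM (kpi t : KP)) IHt IHu.
Qed.

End Universal.

Definition basic_ideal (I : set KP) : Prop :=
  nuideal I /\
  forall (v : kobj L) (c : R), c != 0 -> I (c *: kp_p v) -> I (kp_p v).

Definition basically_simple : Prop :=
  forall I : set KP, basic_ideal I -> I = [set 0] \/ I = setT.

End KumjianPask.

(* Main.v *)
Require Import Defs.
From HB Require Import structures.
From mathcomp Require Import all_boot all_order all_algebra.
From mathcomp Require Import boolp classical_sets functions cardinality.

(* A set on which the paths of [L] act as they do on infinite paths yields a
   representation of KP by operators on its [R]-valued functions, whose kernel
   is always a basic ideal.
   - If [v] is not connected to an infinite path [x], the representation on the
     paths all of whose vertices are connected to [x] kills [p_v] but not
     [p_{x(0)}].
   - If aperiodicity fails, there are [a], [b] of different degrees with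
     [a z = b z] for all infinite paths [z] from [s(a) = s(b)], so that
     [s_a - s_b] is killed by the representation on infinite paths; the same
     representation with the degree recorded shows that [s_a <> s_b].
   Conversely, write a nonzero element of a basic ideal as
   [sum r_{a,b} s_a s_b^*] with all [b] of the same degree.  Compressing it to
   [s_{a0}^* _ s_{b0}] and then by a path that aperiodicity provides to separate
   [a0] from the other [a], one is left with [r p_v], [r <> 0], so the ideal
   contains [p_v].  The set of [w] such that [p_w] is in the ideal is hereditary
   and saturated: if it misses some [w], there is an infinite path from [w]
   avoiding it, which contradicts cofinality. *)

Set Implicit Arguments.
Unset Strict Implicit.
Unset Printing Implicit Defensive.

Import GRing.Theory.
Local Open Scope ring_scope.
Local Arguments numul : simpl never.

(** * Degrees and factorization of paths *)

Section Degrees.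
Variable k : nat.
Implicit Types m n p : deg k.

Lemma deg_le_addr m n : deg_le m (m + n).
Proof. by apply/forallP => i; rewrite !ffunE leq_addr. Qed.

Lemma deg_addK m n : deg_sub (m + n) m = n.
Proof. by apply/ffunP => i; rewrite !ffunE addKn. Qed.

Lemma deg_le0 n : deg_le 0 n.
Proof. by apply/forallP => i; rewrite !ffunE. Qed.

Lemma deg_maxl m n : deg_le m (deg_max m n).
Proof. by apply/forallP => i; rewrite !ffunE leq_maxl. Qed.

Lemma deg_maxr m n : deg_le n (deg_max m n).
Proof. by apply/forallP => i; rewrite !ffunE leq_maxr. Qed.

Lemma deg_addr_eq0 m n : m + n = 0 -> m = 0.
Proof.
move=> /ffunP e; apply/ffunP => i; have := e i; rewrite !ffunE => /eqP.
by rewrite addn_eq0 => /andP[/eqP].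
Qed.

Lemma deg_sub_maxI m n :
  deg_sub (deg_max m n) m = deg_sub (deg_max m n) n -> m = n.
Proof.
move=> /ffunP e; apply/ffunP => i; have := e i; rewrite !ffunE => {}e.
by have := subKn (leq_maxl (m i) (n i)); rewrite e subKn ?leq_maxr.
Qed.

Lemma deg_le_shift m n p : deg_le m n -> deg_le n p ->
  deg_le (m + deg_sub p n) p.
Proof.
move=> /forallP mn /forallP np; apply/forallP => i; rewrite !ffunE.
by rewrite -{2}(subnKC (np i)) leq_add2r.
Qed.

End Degrees.

(** * Prefixes, heads and tails of finite paths *)

Section Paths.
Variables (k : nat) (L : kgraph k).
Implicit Types (a b c l : kmor L) (m n p : deg k) (v w : kobj L).

Definition kprefix a l := exists2 b, ks a = kr b & l = kcomp a b.

(** Uniqueness in the factorization property, read as a cancellation law: equal degrees of the first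
    factors force equal degrees of the second ones. *)
Lemma kcomp_inj a b a' b' : ks a = kr b -> ks a' = kr b' -> kd a = kd a' ->
  kcomp a b = kcomp a' b' -> a = a' /\ b = b'.
Proof.
move=> ab ab' daa' E; have dE := kd_comp ab; have dE' := kd_comp ab'.
have dbb' : kd b = kd b'.
  by apply: (@deg_addI _ (kd a)); rewrite -dE [X in X + _]daa' -dE' E.
have [q [_ qU]] := kfactor dE.
have e1 : q = (a, b) by apply: qU.
by have : q = (a', b') by [apply: qU; split]; rewrite e1 => -[].
Qed.

(** If [kd l] is 0, then [kid (kr l)] followed by [l], and [l] followed by [kid (ks l)], are two
    factorizations of [l] with first factors of degree 0; cancellation identifies these factors. *)
Lemma kid_eq l : kd l = 0 -> l = kid (kr l).
Proof.
move=> d0; have [] := @kcomp_inj (kid (kr l)) l l (kid (ks l)).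
- by rewrite ks_id.
- by rewrite kr_id.
- by rewrite kd_id.
- by rewrite kcomp_idl kcomp_idr.
by move=> /esym.
Qed.

Lemma ksplit l n : deg_le n (kd l) ->
  {ab | [/\ kd ab.1 = n, ks ab.1 = kr ab.2 & l = kcomp ab.1 ab.2]}.
Proof.
move=> nl; apply: cid.
have [ab [[d1 _ s12 e] _]] := kfactor (esym (deg_subK nl)).
by exists ab.
Qed.

(** Total in [n]: the pair [(l, l)] is a dummy value when [n] is not below [kd l]. *)
Definition kpair n l : kmor L * kmor L :=
  if boolP (deg_le n (kd l)) is AltTrue nl then sval (ksplit nl) else (l, l).

Definition khead n l := (kpair n l).1.
Definition ktail n l := (kpair n l).2.

Lemma kheadtailP n l : deg_le n (kd l) ->
  [/\ kd (khead n l) = n, ks (khead n l) = kr (ktail n l)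
    & l = kcomp (khead n l) (ktail n l)].
Proof.
rewrite /khead /ktail /kpair; case: {-}_ / boolP => [nl _|/negP //].
by case: (ksplit nl).
Qed.

Lemma khead_comp a b : ks a = kr b -> khead (kd a) (kcomp a b) = a.
Proof.
move=> ab; have le : deg_le (kd a) (kd (kcomp a b)).
  by rewrite kd_comp// deg_le_addr.
by have [d s e] := kheadtailP le; have [] := kcomp_inj s ab d (esym e).
Qed.

Lemma ktail_comp a b : ks a = kr b -> ktail (kd a) (kcomp a b) = b.
Proof.
move=> ab; have le : deg_le (kd a) (kd (kcomp a b)).
  by rewrite kd_comp// deg_le_addr.
by have [d s e] := kheadtailP le; have [] := kcomp_inj s ab d (esym e).
Qed.

Lemma kprefix_refl a : kprefix a a.
Proof. by exists (kid (ks a)); rewrite ?kr_id ?kcomp_idr. Qed.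

Lemma kprefix_trans b a c : kprefix a b -> kprefix b c -> kprefix a c.
Proof.
move=> [x ax ->] [y]; rewrite ks_comp// => xy ->.
by exists (kcomp x y); rewrite ?kr_comp ?kcompA.
Qed.

Lemma kprefix_comp a b : ks a = kr b -> kprefix a (kcomp a b).
Proof. by move=> ab; exists b. Qed.

Lemma kprefix_compl l a b : ks l = kr a -> kprefix a b ->
  kprefix (kcomp l a) (kcomp l b).
Proof. by move=> la [x ax ->]; exists x; rewrite ?ks_comp ?kcompA. Qed.

Lemma kprefix_eq a b l : kprefix a l -> kprefix b l -> kd a = kd b -> a = b.
Proof. by move=> [x ax ->] [y bY e] d; have [] := kcomp_inj ax bY d e. Qed.

Lemma khead_prefix n l : deg_le n (kd l) -> kprefix (khead n l) l.
Proof. by move=> /kheadtailP[_ s e]; exists (ktail n l). Qed.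

Lemma kd_khead n l : deg_le n (kd l) -> kd (khead n l) = n.
Proof. by case/kheadtailP. Qed.

Lemma kr_khead n l : deg_le n (kd l) -> kr (khead n l) = kr l.
Proof. by case/kheadtailP => _ s e; rewrite {2}e kr_comp. Qed.

Lemma khead_eq n a l : kprefix a l -> kd a = n -> khead n l = a.
Proof. by move=> [b ab ->] <-; apply: khead_comp. Qed.

(** The head of [b] of degree [kd a] is a prefix of [l] with the degree of [a], hence it is [a]. *)
Lemma kprefix_le a b l : kprefix a l -> kprefix b l -> deg_le (kd a) (kd b) ->
  kprefix a b.
Proof.
move=> al bl ab; have hb := khead_prefix ab.
have -> // : a = khead (kd a) b.
by apply: kprefix_eq al (kprefix_trans hb bl) _; rewrite kd_khead.
Qed.

Lemma kprefix_kr a b : kprefix a b -> kr a = kr b.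
Proof. by move=> [x ax ->]; rewrite kr_comp. Qed.

End Paths.

(** * Relations in a Kumjian-Pask family *)

Local Notation "x ** y" := (numul x y) (at level 40, left associativity).

Section NonUnital.
Variables (R : comNzRingType) (A : nualg R).
Implicit Types x y z : A.

Lemma numul0l y : 0 ** y = 0.
Proof. by apply: (addrI (0 ** y)); rewrite -numulDl !addr0. Qed.

Lemma numul0r x : x ** 0 = 0.
Proof. by apply: (addrI (x ** 0)); rewrite -numulDr !addr0. Qed.

Lemma numul_suml I (s : seq I) (F : I -> A) y :
  (\sum_(i <- s) F i) ** y = \sum_(i <- s) F i ** y.
Proof. by elim/big_rec2: _ => [|i u v _ <-]; rewrite ?numul0l ?numulDl. Qed.

Lemma numul_sumr I (s : seq I) (F : I -> A) x :
  x ** (\sum_(i <- s) F i) = \sum_(i <- s) x ** F i.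
Proof. by elim/big_rec2: _ => [|i u v _ <-]; rewrite ?numul0r ?numulDr. Qed.

Lemma nuideal_sum (I : set A) (J : eqType) (s : seq J) (F : J -> A) :
  nuideal I -> (forall j, j \in s -> I (F j)) -> I (\sum_(j <- s) F j).
Proof.
move=> [I0 ID _ _]; elim: s => [|j s IHs] IF; first by rewrite big_nil.
rewrite big_cons; apply: ID; first by apply: IF; rewrite mem_head.
by apply: IHs => i si; apply: IF; rewrite in_cons si orbT.
Qed.

End NonUnital.

(** * Kumjian-Pask families extended to paths of degree 0 *)

Section Family.
Variables (k : nat) (hk : (0 < k)%N) (L : kgraph k).
Variables (hfin : row_finite L) (hsrc : no_sources L).
Implicit Types (a b c l m : kmor L) (v w : kobj L) (n : deg k).

Lemma vpaths_subproof v n :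
  {s : seq (kmor L) | uniq s & forall l, l \in s <-> kr l = v /\ kd l = n}.
Proof.
apply: cid2; have /finite_seqP[s sE] := hfin v n.
exists (undup s); first exact: undup_uniq.
by move=> l; rewrite mem_undup; have := congr1 (@^~ l) sE; rewrite /= => <-.
Qed.

Definition vpaths v n := s2val (vpaths_subproof v n).

Lemma vpaths_uniq v n : uniq (vpaths v n).
Proof. by rewrite /vpaths; case: vpaths_subproof. Qed.

Lemma mem_vpaths v n l : l \in vpaths v n <-> kr l = v /\ kd l = n.
Proof. by rewrite /vpaths; case: vpaths_subproof => s _ /= ->. Qed.

(** [KP2] speaks of composable pairs, so reading off its relations for a single path takes a path of
    nonzero degree at its source. The degree (1,...,1) is nonzero because [k] is positive. *)
Lemma exists_npath v : exists x : npath L, kr (val x) = v.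
Proof.
have [l [rl dl]] := hsrc v [ffun=> 1%N].
have l0 : kd l != 0.
  by apply/eqP => /ffunP/(_ (Ordinal hk)); rewrite dl !ffunE.
by exists (exist _ l l0).
Qed.

Variables (R : comNzRingType) (A : nualg R).
Variables (P : kobj L -> A) (S G : npath L -> A).
Hypothesis fam : KP_family P S G.

(** At degree 0 [insub] fails and [l] is the identity of [kr l], so vertices are sent to their
    idempotents and the relations become uniform in the degree. *)
Definition spath l : A := if insub l is Some x then S x else P (kr l).
Definition gpath l : A := if insub l is Some x then G x else P (kr l).

Lemma spath_val (x : npath L) : spath (val x) = S x.
Proof. by rewrite /spath valK. Qed.
Lemma gpath_val (x : npath L) : gpath (val x) = G x.
Proof. by rewrite /gpath valK. Qed.

Lemma spath_id v : spath (kid v) = P v.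
Proof. by rewrite /spath insubF ?kr_id // kd_id eqxx. Qed.
Lemma gpath_id v : gpath (kid v) = P v.
Proof. by rewrite /gpath insubF ?kr_id // kd_id eqxx. Qed.

Variant kpath_spec : kmor L -> Prop :=
| PathId v : kpath_spec (kid v)
| PathVal (x : npath L) : kpath_spec (val x).

Lemma kpathP l : kpath_spec l.
Proof.
have [/kid_eq ->|l0] := eqVneq (kd l) 0; first exact: PathId.
exact: (PathVal (exist _ l l0)).
Qed.

Lemma P_idem v : P v ** P v = P v.
Proof. by rewrite (KP1 fam) eqxx. Qed.

Lemma PS_rels (x : npath L) :
  [/\ P (kr (val x)) ** S x = S x, S x ** P (ks (val x)) = S x,
      P (ks (val x)) ** G x = G x & G x ** P (kr (val x)) = G x].
Proof. by have [y ye] := exists_npath (ks (val x)); case: (KP2 fam ye). Qed.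

Lemma P_spath l : P (kr l) ** spath l = spath l.
Proof.
case: l / (kpathP l) => [v|x]; first by rewrite kr_id spath_id P_idem.
by rewrite spath_val; case: (PS_rels x).
Qed.

Lemma spath_P l : spath l ** P (ks l) = spath l.
Proof.
case: l / (kpathP l) => [v|x]; first by rewrite ks_id spath_id P_idem.
by rewrite spath_val; case: (PS_rels x).
Qed.

Lemma P_gpath l : P (ks l) ** gpath l = gpath l.
Proof.
case: l / (kpathP l) => [v|x]; first by rewrite ks_id gpath_id P_idem.
by rewrite gpath_val; case: (PS_rels x).
Qed.

Lemma gpath_P l : gpath l ** P (kr l) = gpath l.
Proof.
case: l / (kpathP l) => [v|x]; first by rewrite kr_id gpath_id P_idem.
by rewrite gpath_val; case: (PS_rels x).
Qed.

Lemma npath_comp (x y : npath L) : ks (val x) = kr (val y) ->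
  exists z : npath L, val z = kcomp (val x) (val y).
Proof.
move=> xy; suff h : kd (kcomp (val x) (val y)) != 0.
  by exists (exist _ (kcomp (val x) (val y)) h).
by rewrite kd_comp//; apply: contra (valP x) => /eqP /deg_addr_eq0 ->.
Qed.

Lemma spath_comp l m : ks l = kr m -> spath l ** spath m = spath (kcomp l m).
Proof.
case: l / (kpathP l) => [v|x].
  by rewrite ks_id spath_id => ->; rewrite kcomp_idl P_spath.
case: m / (kpathP m) => [v|y xy].
  by rewrite kr_id spath_id => <-; rewrite kcomp_idr spath_P.
have [z zE] := npath_comp xy; rewrite -zE !spath_val.
by have [/(_ z zE)[]] := KP2 fam (esym xy).
Qed.

Lemma gpath_comp l m : ks l = kr m -> gpath m ** gpath l = gpath (kcomp l m).
Proof.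
case: l / (kpathP l) => [v|x].
  by rewrite ks_id gpath_id => ->; rewrite kcomp_idl gpath_P.
case: m / (kpathP m) => [v|y xy].
  by rewrite kr_id gpath_id => <-; rewrite kcomp_idr P_gpath.
have [z zE] := npath_comp xy; rewrite -zE !gpath_val.
by have [/(_ z zE)[]] := KP2 fam (esym xy).
Qed.

Lemma gpath_spath l m : kd l = kd m ->
  gpath l ** spath m = if l == m then P (ks l) else 0.
Proof.
case: l / (kpathP l) => [v|x].
  rewrite kd_id => /esym/kid_eq ->; rewrite gpath_id spath_id (KP1 fam) ks_id.
  by rewrite (can_eq (g := @kr _ L)) // => w; rewrite kr_id.
case: m / (kpathP m) => [v|y xy].
  by rewrite kd_id => x0; have := valP x; rewrite /= x0 eqxx.
by rewrite gpath_val spath_val (KP3 fam xy) (inj_eq val_inj).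
Qed.

Lemma P_sum v n : P v = \sum_(l <- vpaths v n) spath l ** gpath l.
Proof.
have [->|n0] := eqVneq n 0.
  have e : perm_eq (vpaths v 0) [:: kid v].
    apply: uniq_perm => //; first exact: vpaths_uniq.
    move=> l; rewrite mem_seq1; apply/idP/eqP => [/mem_vpaths[<- /kid_eq]//|->].
    by apply/mem_vpaths; rewrite kr_id kd_id.
  by rewrite (perm_big _ e) big_seq1 spath_id gpath_id P_idem.
(* Since [n] is nonzero, [insub] succeeds on every listed path and [pmap] drops none. *)
pose e : seq (npath L) := pmap insub (vpaths v n).
have eE : map val e = vpaths v n.
  rewrite (pmap_filter (insubK _)); apply/all_filterP/allP => l.
  move=> /mem_vpaths[_ dl].
  by rewrite isSome_insub dl.
rewrite (KP4 fam n0 (e := e)) -?eE ?big_map.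
  by apply: eq_bigr => x _; rewrite spath_val gpath_val.
split; first by rewrite -(map_inj_uniq val_inj) eE vpaths_uniq.
by move=> x; rewrite -(mem_map val_inj) eE; apply: mem_vpaths.
Qed.

(** Inserting [P_sum] at the source of [l] prolongs it by any degree; this and [gpath_sum] bring
    paths to a common degree. *)
Lemma spath_sum l n :
  spath l = \sum_(a <- vpaths (ks l) n) spath (kcomp l a) ** gpath a.
Proof.
rewrite -{1}(spath_P l) (P_sum (ks l) n) numul_sumr; apply: eq_big_seq => a.
by move=> /mem_vpaths[ra _]; rewrite numulA spath_comp.
Qed.

Lemma gpath_sum l n :
  gpath l = \sum_(a <- vpaths (ks l) n) spath a ** gpath (kcomp l a).
Proof.
rewrite -{1}(P_gpath l) (P_sum (ks l) n) numul_suml; apply: eq_big_seq => a.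
by move=> /mem_vpaths[ra _]; rewrite -numulA gpath_comp.
Qed.

(* [l = a c = b e] runs over the minimal common extensions of [a] and [b]. *)
Lemma gpath_spath_sum a b : let p := deg_max (kd a) (kd b) in
  gpath a ** spath b =
    \sum_(c <- vpaths (ks a) (deg_sub p (kd a)))
      \sum_(e <- vpaths (ks b) (deg_sub p (kd b)))
        if kcomp a c == kcomp b e then spath c ** gpath e else 0.
Proof.
move=> p; rewrite (gpath_sum a (deg_sub p (kd a))).
rewrite (spath_sum b (deg_sub p (kd b))) numul_suml; apply: eq_big_seq => c.
move=> /mem_vpaths[rc dc]; rewrite numul_sumr; apply: eq_big_seq => e.
move=> /mem_vpaths[re de]; rewrite numulA -(numulA (spath c)) gpath_spath.
  case: eqP => _; last by rewrite numul0r numul0l.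
  by rewrite ks_comp// spath_P.
by rewrite !kd_comp// dc de !deg_subK// ?deg_maxl ?deg_maxr.
Qed.

Lemma gpath_spath0 a b :
  (forall c e, ks a = kr c -> ks b = kr e -> kcomp a c <> kcomp b e) ->
  gpath a ** spath b = 0.
Proof.
move=> h; rewrite gpath_spath_sum big_seq big1 // => c /mem_vpaths[rc _].
rewrite big_seq big1 // => e /mem_vpaths[re _].
by case: eqP => // /(h _ _ (esym rc) (esym re)).
Qed.

End Family.

(** * Normal forms and aperiodicity *)

Section Aperiodicity.
Variables (k : nat) (L : kgraph k).
Implicit Types (a b c e l : kmor L) (m n p t : deg k).

(** Replaces [segment], defined by choice, by the middle factor of an explicit factorization, found
    by splitting twice. *)
Lemma segment_split l m n : deg_le (m + n) (kd l) ->
  exists a b c, [/\ kd a = m, kd b = n, ks a = kr b, ks b = kr c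
    & l = kcomp a (kcomp b c) /\ segment l m (m + n) = b].
Proof.
move=> mnl; have [d1 s1 e1] := kheadtailP mnl.
have mn : deg_le m (kd (khead (m + n) l)) by rewrite d1 deg_le_addr.
have [d2 s2 e2] := kheadtailP mn; move: d1 s1 e1 d2 s2 e2.
set x := khead (m + n) l; set c := ktail _ l; set a := khead m x.
set b := ktail m x => d1 s1 e1 d2 s2 e2.
have db : kd b = n.
  by apply: (@deg_addI _ m); rewrite -d1 e2 kd_comp// d2.
have bc : ks b = kr c by rewrite -s1 e2 ks_comp.
have el : l = kcomp a (kcomp b c) by rewrite kcompA// -e2.
by exists a, b, c; split => //; split => //; rewrite {1}el -d2 -db segmentE.
Qed.

(* Above the degree [d(a0) \/ d(a)], a common extension of [a0 l] and [a l]
   would identify the two segments of [l] that aperiodicity distinguishes. *)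
Lemma aperiodic_separate (a0 a : kmor L) : aperiodic L -> a <> a0 ->
  ks a = ks a0 ->
  exists2 l, kr l = ks a0 & forall c e, ks l = kr c -> ks l = kr e ->
    kcomp (kcomp a0 l) c <> kcomp (kcomp a l) e.
Proof.
move=> ap aNa0 sa.
(* Distinct paths of equal degree have no common extension, by cancellation, so a vertex serves as
   [l]. *)
have [da|/eqP da] := eqVneq (kd a) (kd a0).
  exists (kid (ks a0)); rewrite ?kr_id // => c e.
  have -> : kcomp a (kid (ks a0)) = a by rewrite -sa kcomp_idr.
  rewrite ks_id kcomp_idr => rc re eq_ae; apply: aNa0.
  by have [] := kcomp_inj rc (etrans sa re) (esym da) eq_ae.
(* [p] and [q] are the positions in [l] at which [a0 l] and [a l] reach degree [M]; they differ
   because the degrees of [a0] and [a] do. *)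
pose M := deg_max (kd a0) (kd a).
pose p := deg_sub M (kd a0); pose q := deg_sub M (kd a).
have pq : p <> q.
  by move=> /deg_sub_maxI /esym.
have [l [rl dl nseg]] := ap (ks a0) _ _ pq; exists l => // c e sc se E.
apply: nseg; set t := deg_sub (kd l) _.
have pt : deg_le (p + t) (kd l).
  exact: deg_le_shift (deg_maxl _ _) dl.
have qt : deg_le (q + t) (kd l).
  exact: deg_le_shift (deg_maxr _ _) dl.
have [x [y [z [dx dy xy yz [el ->]]]]] := segment_split pt.
have [x' [y' [z' [dx' dy' xy' yz' [el' ->]]]]] := segment_split qt.
have rx : ks a0 = kr x by rewrite -rl el kr_comp ?kr_comp.
have rx' : ks a = kr x' by rewrite sa -rl el' kr_comp ?kr_comp.
have sax : ks (kcomp a0 x) = kr y by rewrite ks_comp.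
have sax' : ks (kcomp a x') = kr y' by rewrite ks_comp.
have pre1 : kprefix (kcomp (kcomp a0 x) y) (kcomp (kcomp a0 l) c).
  apply: kprefix_trans (kprefix_comp _); last by rewrite ks_comp.
  rewrite el -kcompA//; apply: kprefix_compl; rewrite ?kr_comp//.
  by rewrite kcompA//; apply: kprefix_comp; rewrite ks_comp.
have pre2 : kprefix (kcomp (kcomp a x') y') (kcomp (kcomp a l) e).
  apply: kprefix_trans (kprefix_comp _); last by rewrite ks_comp// rl.
  rewrite el' -kcompA//; apply: kprefix_compl; rewrite ?kr_comp//.
  by rewrite kcompA//; apply: kprefix_comp; rewrite ks_comp.
have dax : kd (kcomp a0 x) = M by rewrite kd_comp// dx deg_subK// deg_maxl.
have dax' : kd (kcomp a x') = M by rewrite kd_comp// dx' deg_subK// deg_maxr.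
(* Both are now prefixes of one path, of the same degree [M + t], and they end with the two segments
   of [l]. *)
rewrite -E in pre2.
have eq_xy : kcomp (kcomp a0 x) y = kcomp (kcomp a x') y'.
  apply: kprefix_eq pre1 pre2 _.
  by rewrite (kd_comp sax) (kd_comp sax') dax dax' dy dy'.
by have [] := kcomp_inj sax sax' (etrans dax (esym dax')) eq_xy.
Qed.

End Aperiodicity.

(** * Spanning elements, and vertex idempotents in ideals *)

Section NormalForm.
Variables (k : nat) (hk : (0 < k)%N) (L : kgraph k).
Variables (hfin : row_finite L) (hsrc : no_sources L) (R : comNzRingType).
Implicit Types (l m : kmor L) (v w : kobj L) (n : deg k) (x y : KP R L).
Implicit Types Q : kmor L * kmor L -> Prop.

Local Notation fam := (KP_familyP R L).
Local Notation p := (@kp_p k R L).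
Local Notation s := (spath (@kp_p k R L) (@kp_s k R L)).
Local Notation g := (gpath (@kp_p k R L) (@kp_g k R L)).

(** The list has no repetition, so each pair carries a single coefficient, which [aperiodic_vertex]
    can isolate. *)
Definition kspan Q x := exists (u : seq (kmor L * kmor L)) (c : _ -> R),
  [/\ uniq u, forall ab, ab \in u -> Q ab &
      x = \sum_(ab <- u) c ab *: (s ab.1 ** g ab.2)].

Lemma kspan0 Q : kspan Q 0.
Proof. by exists [::], (fun=> 0); split; rewrite ?big_nil. Qed.

Lemma kspanZ Q c x : kspan Q x -> kspan Q (c *: x).
Proof.
move=> [u [f [uu uQ ->]]]; exists u, (fun ab => c * f ab); split => //.
by rewrite scaler_sumr; apply: eq_bigr => ab _; rewrite scalerA.
Qed.

Lemma sum_extend (I : eqType) (V : lmodType R) (u u' : seq I) (f : I -> R)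
    (F : I -> V) : uniq u -> uniq u' -> {subset u <= u'} ->
  \sum_(i <- u) f i *: F i = \sum_(i <- u') (if i \in u then f i else 0) *: F i.
Proof.
move=> uu uu' sub; have e : perm_eq u [seq i <- u' | i \in u].
  apply: uniq_perm; rewrite ?filter_uniq // => i; rewrite mem_filter.
  by case: (boolP (i \in u)) => // /sub ->.
rewrite (perm_big _ e) big_filter big_mkcond; apply: eq_bigr => i _.
by case: ifP; rewrite ?scale0r.
Qed.

Lemma kspanD Q x y : kspan Q x -> kspan Q y -> kspan Q (x + y).
Proof.
move=> [u [f [uu uQ ->]]] [u' [f' [uu' uQ' ->]]].
pose w := undup (u ++ u').
exists w, (fun ab => (if ab \in u then f ab else 0) +
                     (if ab \in u' then f' ab else 0)).
split; first exact: undup_uniq.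
  by move=> ab; rewrite mem_undup mem_cat => /orP[/uQ|/uQ'].
rewrite (sum_extend (u' := w))//; last first.
- by move=> ab abu; rewrite mem_undup mem_cat abu.
- exact: undup_uniq.
rewrite (sum_extend (u := u') (u' := w))//; last first.
- by move=> ab abu; rewrite mem_undup mem_cat abu orbT.
- exact: undup_uniq.
by rewrite -big_split; apply: eq_bigr => ab _; rewrite scalerDl.
Qed.

Lemma kspan_mono Q a b : Q (a, b) -> kspan Q (s a ** g b).
Proof.
move=> Qab; exists [:: (a, b)], (fun=> 1); split => //.
  by move=> ab; rewrite inE => /eqP ->.
by rewrite big_seq1 scale1r.
Qed.

Lemma kspan_sum Q (I : eqType) (u : seq I) (F : I -> KP R L) :
  (forall i, i \in u -> kspan Q (F i)) -> kspan Q (\sum_(i <- u) F i).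
Proof.
elim: u => [|i u IHu] uF; first by rewrite big_nil; apply: kspan0.
rewrite big_cons; apply: kspanD; first by apply: uF; rewrite mem_head.
by apply: IHu => j ju; apply: uF; rewrite in_cons ju orbT.
Qed.

Let cosource (ab : kmor L * kmor L) := ks ab.1 = ks ab.2.

(** The inner factor [g b ** s c] expands into terms [s i ** g j] with [b i = c j]; then [i] and [j]
    have the same source, and the outer factors absorb them into [s (a i) ** g (d j)]. *)
Lemma kspan_mul x y : kspan cosource x -> kspan cosource y ->
  kspan cosource (x ** y).
Proof.
move=> [u [f [_ uQ ->]]] [u' [f' [_ uQ' ->]]].
rewrite numul_suml; apply: kspan_sum => -[a b] /uQ /= sab.
rewrite numul_sumr; apply: kspan_sum => -[c d] /uQ' /= scd.
rewrite -nuscaleAl -nuscaleAr; do 2!apply: kspanZ.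
rewrite numulA -(numulA (s a)) (gpath_spath_sum hk hfin hsrc fam).
rewrite numul_sumr numul_suml; apply: kspan_sum => i /mem_vpaths[ri _].
rewrite numul_sumr numul_suml; apply: kspan_sum => j /mem_vpaths[rj _].
case: eqP => [E|_]; last by rewrite numul0r numul0l; apply: kspan0.
rewrite numulA (spath_comp hk hsrc fam) ?sab// -numulA.
rewrite (gpath_comp hk hsrc fam) -?scd//.
apply: kspan_mono; rewrite /cosource/= !ks_comp// -?scd ?sab //.
by have := congr1 (@ks _ _) E; rewrite !ks_comp.
Qed.

(** Induction on a term representing [x]; each generator is completed by a vertex idempotent. *)
Lemma kspan_KP x : kspan cosource x.
Proof.
rewrite -(kpi_repr x).
elim: (repr (x : kpcar R L)) =>
  [v|l|l||t IHt|t IHt u IHu|c t IHt|t IHt u IHu].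
- have -> : kpi (TP R v) = s (kid v) ** g (kid v).
    by rewrite spath_id gpath_id (P_idem fam).
  exact: kspan_mono.
- have -> : kpi (TS R l) = s (val l) ** g (kid (ks (val l))).
    by rewrite gpath_id (spath_P hk hsrc fam) spath_val.
  by apply: kspan_mono; rewrite /cosource/= ks_id.
- have -> : kpi (TG R l) = s (kid (ks (val l))) ** g (val l).
    by rewrite spath_id (P_gpath hk hsrc fam) gpath_val.
  by apply: kspan_mono; rewrite /cosource/= ks_id.
- exact: kspan0.
- have -> : kpi (TOpp t) = -1 *: (kpi t : KP R L).
    by rewrite scaleN1r; apply/esym/kpi_opp.
  exact: kspanZ.
- have -> : kpi (TAdd t u) = (kpi t : KP R L) + kpi u by apply/esym/kpi_add.
  exact: kspanD.
- have -> : kpi (TScale c t) = c *: (kpi t : KP R L) by apply/esym/kpi_scale.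
  exact: kspanZ.
- have -> : kpi (TMul t u) = (kpi t : KP R L) ** kpi u by apply/esym/kpi_mul.
  exact: kspan_mul.
Qed.

Lemma deg_le_sum (I : eqType) (u : seq I) (F : I -> deg k) i :
  i \in u -> deg_le (F i) (\sum_(j <- u) F j).
Proof. by move=> iu; rewrite (big_rem i)//= deg_le_addr. Qed.

(** The sum of the degrees of all right-hand paths bounds each of them, and [gpath_sum] prolongs
    every [b] up to that degree. *)
Lemma kspan_normal x :
  exists n, kspan (fun ab => ks ab.1 = ks ab.2 /\ kd ab.2 = n) x.
Proof.
have [u [f [uu uQ xE]]] := kspan_KP x.
exists (\sum_(ab <- u) kd ab.2); set n := \sum_(_ <- _) _.
rewrite xE; apply: kspan_sum => -[a b] abu; have /= sab := uQ _ abu.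
apply: kspanZ; rewrite /= (gpath_sum hk hfin hsrc fam b (deg_sub n (kd b))).
rewrite numul_sumr; apply: kspan_sum => c /mem_vpaths[rc dc].
rewrite numulA (spath_comp hk hsrc fam) ?sab//; apply: kspan_mono => /=.
by rewrite !ks_comp ?sab// kd_comp// dc deg_subK// (deg_le_sum _ abu).
Qed.

(** Induction on [u]: an extension [l'] separates the next [a l] from [a0 l], and products already
    zero stay zero, being only multiplied by [g l'] and [s l'] on the two sides. *)
Lemma aperiodic_kill (u : seq (kmor L)) (a0 : kmor L) : aperiodic L ->
  (forall a, a \in u -> a <> a0 /\ ks a = ks a0) ->
  exists2 l, kr l = ks a0 &
    forall a, a \in u -> g (kcomp a0 l) ** s (kcomp a l) = 0.
Proof.
move=> ap; elim: u => [|a u IHu] ua.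
  by exists (kid (ks a0)); rewrite ?kr_id.
have [aNa0 sa] := ua a (mem_head _ _).
have [|l rl lP] := IHu.
  by move=> b bu; apply: ua; rewrite in_cons bu orbT.
have s0l : ks (kcomp a0 l) = ks l by rewrite ks_comp.
have sl b : b \in a :: u -> ks (kcomp b l) = ks l.
  by move=> /ua[_ sb]; rewrite ks_comp ?sb.
have neq : kcomp a l <> kcomp a0 l.
  move=> E; apply: aNa0; have := kd_comp (etrans sa (esym rl)).
  rewrite E kd_comp// ![_ + kd l]addrC => /deg_addI da.
  by have [] := kcomp_inj (etrans sa (esym rl)) (esym rl) (esym da) E.
have [|l' rl' l'P] := aperiodic_separate ap neq.
  by rewrite sl ?mem_head.
rewrite s0l in rl'; exists (kcomp l l'); first by rewrite kr_comp.
move=> b bau; have [_ sb] := ua b bau; rewrite !kcompA ?sb//.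
move: bau (sl b bau); rewrite in_cons => /predU1P[->|bu] slb.
  apply: (gpath_spath0 hk hfin hsrc fam) => c e.
  rewrite (ks_comp (l := kcomp a0 l)) ?s0l// (ks_comp (l := kcomp a l)) ?slb//.
  exact: l'P.
rewrite -(gpath_comp hk hsrc fam) ?s0l// -(spath_comp hk hsrc fam) ?slb//.
by rewrite numulA -(numulA (g l')) lP// numul0r numul0l.
Qed.

Lemma aperiodic_vertex (I : set (KP R L)) x : aperiodic L -> nuideal I -> I x ->
  x <> 0 -> exists v c, c != 0 /\ I (c *: p v).
Proof.
move=> ap [_ _ _ IM] Ix x0; have [n [u [f [uu uQ xE]]]] := kspan_normal x.
have [[a0 b0] abu0 /= f0] : exists2 ab, ab \in u & f ab != 0.
  apply: contrapT => h; apply: x0; rewrite xE big_seq big1 // => ab abu.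
  have [->|f0] := eqVneq (f ab) 0; first by rewrite scale0r.
  by case: h; exists ab.
have [/= sab0 db0] := uQ _ abu0.
(* The left-hand paths, other than [a0], that occur together with [b0]. *)
pose t := [seq ab.1 | ab <- u & (ab.2 == b0) && (ab.1 != a0)].
have [|l rl lP] := @aperiodic_kill t a0 ap.
  move=> a /mapP[[a' b]]; rewrite mem_filter.
  move=> /andP[/andP[/eqP/= -> /eqP a'Na0]].
  by move=> /uQ[/= sa' _] ->; rewrite sa' sab0.
exists (ks l), (f (a0, b0)); split => //.
have rbl : ks b0 = kr l by rewrite -sab0.
suff -> : f (a0, b0) *: p (ks l) = g (kcomp a0 l) ** x ** s (kcomp b0 l).
  by have [_ ] := IM (s (kcomp b0 l)) _ (proj1 (IM (g (kcomp a0 l)) _ Ix)).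
rewrite -(spath_comp hk hsrc fam)// numulA -(numulA _ x).
(* All right-hand paths have the degree of [b0], so only the terms with [b = b0] survive. *)
have -> : x ** s b0 = \sum_(ab <- u) if ab.2 == b0 then f ab *: s ab.1 else 0.
  rewrite xE numul_suml; apply: eq_big_seq => -[a b] /uQ[/= sab db].
  rewrite -nuscaleAl -numulA (gpath_spath fam) ?db ?db0//.
  by case: eqP => _; rewrite ?numul0r ?scaler0// -sab (spath_P hk hsrc fam).
(* The pair [(a0, b0)] yields the idempotent; any other surviving pair has its left path in [t] and
   is killed by the choice of [l]. *)
rewrite numul_sumr numul_suml (bigD1_seq (a0, b0))//= eqxx big_seq_cond big1.
  rewrite addr0 -nuscaleAr -nuscaleAl -numulA (spath_comp hk hsrc fam)//.
  by rewrite (gpath_spath fam)// eqxx ks_comp.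
move=> [a b] /andP[abu abN].
case: eqP => [/= bE|_]; last by rewrite numul0r numul0l.
have [/= sab _] := uQ _ abu.
have sal : ks a = kr l by rewrite sab bE.
rewrite -nuscaleAr -nuscaleAl -numulA (spath_comp hk hsrc fam)// lP ?scaler0//.
apply/mapP; exists (a, b) => //; rewrite mem_filter /= abu bE eqxx andbT.
by apply: contra abN => /eqP ->; rewrite bE.
Qed.

Lemma ideal_hereditary (I : set (KP R L)) l : nuideal I -> I (p (kr l)) ->
  I (p (ks l)).
Proof.
move=> [_ _ _ IM] Il.
have -> : p (ks l) = g l ** p (kr l) ** s l.
  by rewrite (gpath_P hk hsrc fam) (gpath_spath fam)// eqxx.
by have [_] := IM (s l) _ (proj1 (IM (g l) _ Il)).
Qed.

(** By [P_sum], [p v] is a sum of terms [s l ** p (ks l) ** g l]. *)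
Lemma ideal_saturated (I : set (KP R L)) v n : nuideal I ->
  (forall l, kr l = v -> kd l = n -> I (p (ks l))) -> I (p v).
Proof.
move=> idI Iv; have [_ _ _ IM] := idI; rewrite (P_sum hfin fam v n).
apply: nuideal_sum idI _ => l /mem_vpaths[rl dl].
rewrite -(spath_P hk hsrc fam l).
by have [_] := IM (g l) _ (proj1 (IM (s l) _ (Iv l rl dl))).
Qed.

Lemma ideal_total (I : set (KP R L)) : nuideal I -> (forall v, I (p v)) ->
  I = setT.
Proof.
move=> idI Ip; have [I0 ID IZ IM] := idI.
apply/seteqP; split => // x _; have [u [f [_ _ ->]]] := kspan_KP x.
apply: nuideal_sum idI _ => ab _; apply: IZ.
rewrite -(P_spath hk hsrc fam ab.1).
by have [_] := IM (g ab.2) _ (proj2 (IM (s ab.1) _ (Ip (kr ab.1)))).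
Qed.

End NormalForm.

(** * Infinite paths *)

Section InfinitePaths.
Variables (k : nat) (L : kgraph k).
Implicit Types (a b c l : kmor L) (m n p q : deg k) (v w : kobj L).

(* Infinite paths encoded by their initial segments, [x n] standing for
   [x(0,n)]. *)
Record ipath := IPath {
  iseg :> deg k -> kmor L;
  kd_iseg : forall n, kd (iseg n) = n;
  iseg_prefix : forall m n, deg_le m n -> kprefix (iseg m) (iseg n)
}.
Implicit Types x y : ipath.

Lemma ipathP x y : x =1 y -> x = y.
Proof.
case: x y => [x dx px] [y dy py] /= /funext xy; subst y.
by congr IPath; apply: Prop_irrelevance.
Qed.

(** Every [n] lies below [m + n], so the segments of degree at least [m] determine all others. *)
Lemma ipath_shiftP x y m : (forall n, x (m + n) = y (m + n)) -> x = y.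
Proof.
move=> xy; apply: ipathP => n.
have nm : deg_le n (m + n) by rewrite addrC deg_le_addr.
apply: (kprefix_eq (iseg_prefix x nm)); last by rewrite !kd_iseg.
by rewrite xy; apply: iseg_prefix.
Qed.

Definition irange x : kobj L := kr (x 0).

Lemma kr_iseg x n : kr (x n) = irange x.
Proof. by apply/esym/kprefix_kr/iseg_prefix/deg_le0. Qed.

Lemma iseg0 x : x 0 = kid (irange x).
Proof. by apply/kid_eq/kd_iseg. Qed.

Section Constructors.
Variables (u : deg k -> kmor L).
Hypothesis du : forall n, deg_le n (kd (u n)).
Hypothesis pu : forall m n, deg_le m n -> kprefix (u m) (u n).

Lemma khead_prefix_mono m n : deg_le m n ->
  kprefix (khead m (u m)) (khead n (u n)).
Proof.
move=> mn; apply: (@kprefix_le _ _ _ _ (u n)).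
- exact: kprefix_trans (khead_prefix (du m)) (pu mn).
- exact: khead_prefix (du n).
- by rewrite !kd_khead.
Qed.

(** The limit of an increasing family of paths with [kd (u n)] at least [n], each cut down to degree
    [n]. *)
Definition ipath_of := IPath (fun n => kd_khead (du n)) khead_prefix_mono.

End Constructors.

Lemma icons_le l x n : ks l = irange x -> deg_le n (kd (kcomp l (x n))).
Proof. by move=> lx; rewrite kd_comp ?kr_iseg// kd_iseg addrC deg_le_addr. Qed.

Lemma icons_prefix l x m n : ks l = irange x -> deg_le m n ->
  kprefix (kcomp l (x m)) (kcomp l (x n)).
Proof.
by move=> lx mn; apply: kprefix_compl (iseg_prefix x mn); rewrite kr_iseg.
Qed.

(** The infinite path [l x]; the value [x] is a dummy when the two do not compose. *)
Definition icons l x : ipath :=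
  if pselect (ks l = irange x) is left lx then
    ipath_of (fun n => icons_le n lx) (fun m n => icons_prefix lx)
  else x.

Lemma iconsE l x n : ks l = irange x -> icons l x n = khead n (kcomp l (x n)).
Proof. by move=> lx; rewrite /icons; case: pselect. Qed.

Lemma icons_add l x n : ks l = irange x ->
  icons l x (kd l + n) = kcomp l (x n).
Proof.
move=> lx; rewrite iconsE//; apply: khead_eq.
  by apply: icons_prefix; rewrite // addrC deg_le_addr.
by rewrite kd_comp ?kr_iseg// kd_iseg.
Qed.

Lemma icons_kd l x : ks l = irange x -> icons l x (kd l) = l.
Proof. by move=> lx; rewrite -[kd l]addr0 icons_add// iseg0 -lx kcomp_idr. Qed.

Lemma irange_icons l x : ks l = irange x -> irange (icons l x) = kr l.
Proof. by move=> lx; rewrite -(kr_iseg _ (kd l)) icons_kd. Qed.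

Lemma icons_comp a b x : ks a = kr b -> ks b = irange x ->
  icons (kcomp a b) x = icons a (icons b x).
Proof.
move=> ab bx; apply: (@ipath_shiftP _ _ (kd a + kd b)) => n.
rewrite -{1}kd_comp// icons_add ?ks_comp// -addrA icons_add ?irange_icons//.
by rewrite icons_add// kcompA ?kr_iseg.
Qed.

Lemma ishift_subproof m x n : deg_le m (kd (x (m + n))).
Proof. by rewrite kd_iseg deg_le_addr. Qed.

Lemma iseg_ktail m x n : [/\ ks (x m) = kr (ktail m (x (m + n))),
  x (m + n) = kcomp (x m) (ktail m (x (m + n))) & kd (ktail m (x (m + n))) = n].
Proof.
have [d s e] := kheadtailP (ishift_subproof m x n).
have hE : khead m (x (m + n)) = x m.
  by apply: khead_eq (kd_iseg x m); apply/iseg_prefix/deg_le_addr.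
rewrite hE in s e; split => //; apply: (@deg_addI _ m).
by rewrite -[in RHS](kd_iseg x (m + n)) [in RHS]e kd_comp// kd_iseg.
Qed.

Lemma ishift_kd m x n : kd (ktail m (x (m + n))) = n.
Proof. by case: (iseg_ktail m x n). Qed.

Lemma ishift_prefix m x n p : deg_le n p ->
  kprefix (ktail m (x (m + n))) (ktail m (x (m + p))).
Proof.
move=> np; have [s e _] := iseg_ktail m x n; have [s' e' _] := iseg_ktail m x p.
have mnp : deg_le (m + n) (m + p).
  by apply/forallP => i; rewrite !ffunE leq_add2l (forallP np).
have [b sb E] := iseg_prefix x mnp.
rewrite {1}e ks_comp// in sb; rewrite e' e -kcompA// in E.
have sb' : ks (x m) = kr (kcomp (ktail m (x (m + n))) b) by rewrite kr_comp.
have [_ ->] := kcomp_inj s' sb' erefl E.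
exact: kprefix_comp.
Qed.

(** The shift of [x] by [m]: its segment of degree [n] is [x(m, m + n)]. *)
Definition ishift m x : ipath := IPath (ishift_kd m x) (@ishift_prefix m x).

Lemma irange_ishift m x : irange (ishift m x) = ks (x m).
Proof. by rewrite -(kr_iseg _ 0); case: (iseg_ktail m x 0). Qed.

Lemma icons_ishift m x : icons (x m) (ishift m x) = x.
Proof.
apply: (@ipath_shiftP _ _ m) => n; have [_ e _] := iseg_ktail m x n.
by have := icons_add n (esym (irange_ishift m x)); rewrite kd_iseg /= -e.
Qed.

Lemma ishift_icons l x : ks l = irange x -> ishift (kd l) (icons l x) = x.
Proof.
move=> lx; apply: ipathP => n /=; rewrite icons_add//.
by rewrite ktail_comp ?kr_iseg.
Qed.

End InfinitePaths.

(** * Passage between initial segments and functors on [Omega] *)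

Section OmegaPaths.
Variables (k : nat) (L : kgraph k).
Implicit Types (x : ipath L) (p q n : deg k).

Lemma omega_seg_subproof x (l : @omega_mor k) :
  exists2 b : kmor L, ks (x (omega_r l)) = kr b &
    x (omega_s l) = kcomp (x (omega_r l)) b.
Proof. by apply: iseg_prefix; apply: (valP l). Qed.

(** The segment [x(p, q)], obtained by cancelling [x(0, p)] from [x(0, q)]. *)
Definition omega_seg x (l : @omega_mor k) : kmor L :=
  sval (cid2 (omega_seg_subproof x l)).

Lemma omega_segP x l : ks (x (omega_r l)) = kr (omega_seg x l) /\
  x (omega_s l) = kcomp (x (omega_r l)) (omega_seg x l).
Proof. by rewrite /omega_seg; case: cid2. Qed.

Lemma omega_seg_eq x l (b : kmor L) : ks (x (omega_r l)) = kr b ->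
  x (omega_s l) = kcomp (x (omega_r l)) b -> omega_seg x l = b.
Proof.
move=> rb xb; have [s e] := omega_segP x l; rewrite xb in e.
by have [] := kcomp_inj rb s erefl e.
Qed.

Lemma omega_seg_id x p : omega_seg x (omega_id p) = kid (ks (x p)).
Proof. by apply: omega_seg_eq; rewrite ?kr_id ?kcomp_idr. Qed.

Lemma omega_seg_r x l : kr (omega_seg x l) = ks (x (omega_r l)).
Proof. by case: (omega_segP x l). Qed.

Lemma omega_seg_s x l : ks (omega_seg x l) = ks (x (omega_s l)).
Proof. by have [s ->] := omega_segP x l; rewrite ks_comp. Qed.

Lemma omega_seg_comp x l l' : omega_s l = omega_r l' ->
  omega_seg x (omega_comp l l') = kcomp (omega_seg x l) (omega_seg x l').
Proof.
move=> ll'; have [s e] := omega_segP x l; have [s' e'] := omega_segP x l'.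
have ss' : ks (omega_seg x l) = kr (omega_seg x l').
  by rewrite omega_seg_s omega_seg_r ll'.
apply: omega_seg_eq; rewrite omega_r_comp//; first by rewrite kr_comp.
by rewrite omega_s_comp// e' -ll' e kcompA.
Qed.

Lemma omega_seg_d x l : kd (omega_seg x l) = omega_d l.
Proof.
have [s e] := omega_segP x l; apply: (@deg_addI _ (omega_r l)).
by rewrite -omega_dE -[in LHS](kd_iseg x (omega_r l)) -kd_comp// -e kd_iseg.
Qed.

Definition omega_path x : infinite_path L :=
  @KGraphHom k (Omega k) L (fun n => ks (x n)) (omega_seg x) (omega_seg_id x)
    (omega_seg_r x) (omega_seg_s x) (@omega_seg_comp x) (omega_seg_d x).

Definition omega0 n : @omega_mor k := exist _ (0, n) (deg_le0 n).

Variable f : infinite_path L.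

Lemma hom_seg_kd n : kd (kh_mor f (omega0 n)) = n.
Proof.
rewrite (kh_d f); apply: (@deg_addI _ 0).
by rewrite -(omega_dE (omega0 n)) add0r.
Qed.

Lemma hom_seg_prefix m n : deg_le m n ->
  kprefix (kh_mor f (omega0 m)) (kh_mor f (omega0 n)).
Proof.
move=> mn; pose l : @omega_mor k := exist _ (m, n) mn.
have ml : omega_s (omega0 m) = omega_r l by [].
have -> : omega0 n = omega_comp (omega0 m) l.
  by apply: omega_inj; rewrite ?omega_r_comp ?omega_s_comp.
rewrite (kh_comp f ml); apply: kprefix_comp.
by rewrite kh_s kh_r /= ml.
Qed.

Definition hom_ipath : ipath L := IPath hom_seg_kd hom_seg_prefix.

Lemma ks_hom_ipath n : ks (hom_ipath n) = f n.
Proof. by rewrite /= kh_s. Qed.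

End OmegaPaths.

(** * Infinite paths built by steps of degree (1,...,1) preserving a vertex property *)

Section PathExistence.
Variables (k : nat) (L : kgraph k) (Q : kobj L -> Prop).
Local Notation one := ([ffun=> 1%N] : deg k).
Hypothesis Qnext : forall v, Q v ->
  {l : kmor L | [/\ kr l = v, kd l = one & Q (ks l)]}.
Variables (v : kobj L) (Qv : Q v).

Let state := {l : kmor L | Q (ks l)}.

Lemma greedy_start_subproof : Q (ks (kid v)).
Proof. by rewrite ks_id. Qed.

Lemma greedy_next_subproof (l : state) :
  Q (ks (kcomp (sval l) (sval (Qnext (svalP l))))).
Proof. by case: (Qnext _) => m [rm dm Qm] /=; rewrite ks_comp. Qed.

Definition greedy_next (l : state) : state :=
  exist _ _ (greedy_next_subproof l).

Definition greedy n : state :=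
  iter n greedy_next (exist _ _ greedy_start_subproof).

Lemma greedy_prefix m n : (m <= n)%N ->
  kprefix (sval (greedy m)) (sval (greedy n)).
Proof.
elim: n => [|n IHn]; first by rewrite leqn0 => /eqP ->; apply: kprefix_refl.
rewrite leq_eqVlt => /predU1P[->|]; first exact: kprefix_refl.
rewrite ltnS => /IHn /kprefix_trans; apply => /=.
by case: (Qnext _) => m' [rm dm Qm] /=; apply: kprefix_comp.
Qed.

Lemma kd_greedy n : kd (sval (greedy n)) = [ffun=> n].
Proof.
elim: n => [|n IHn] /=.
  by rewrite kd_id; apply/ffunP => i; rewrite !ffunE.
case: (Qnext _) => m' [rm dm Qm] /=; rewrite kd_comp// IHn dm.
by apply/ffunP => i; rewrite !ffunE; apply: addn1.
Qed.

Lemma kr_greedy n : kr (sval (greedy n)) = v.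
Proof. by rewrite -(kprefix_kr (greedy_prefix (leq0n n))) kr_id. Qed.

(** A monotone bound on all coordinates: after [height n] diagonal steps the degree is above [n]. *)
Definition height (n : deg k) := \sum_i n i.

Lemma le_height (n : deg k) i : (n i <= height n)%N.
Proof. by rewrite /height (bigD1 i)//= leq_addr. Qed.

Lemma greedy_le n : deg_le n (kd (sval (greedy (height n)))).
Proof. by rewrite kd_greedy; apply/forallP => i; rewrite ffunE le_height. Qed.

Lemma height_mono (m n : deg k) : deg_le m n -> (height m <= height n)%N.
Proof. by move=> /forallP mn; apply: leq_sum. Qed.

Lemma greedy_mono m n : deg_le m n ->
  kprefix (sval (greedy (height m))) (sval (greedy (height n))).
Proof. by move=> /height_mono /greedy_prefix. Qed.

Definition greedy_path : ipath L := ipath_of greedy_le greedy_mono.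

Lemma irange_greedy : irange greedy_path = v.
Proof.
by rewrite /irange /= kr_khead ?greedy_le// kr_greedy.
Qed.

(** [Q] is maintained only at the diagonal vertices, but the rest of the finite path truncated at
    [n] leads to one of them. *)
Lemma greedy_pathP n : exists2 l, ks (greedy_path n) = kr l & Q (ks l).
Proof.
have [d s e] := kheadtailP (greedy_le n).
exists (ktail n (sval (greedy (height n)))) => //.
have : ks (sval (greedy (height n))) = ks (ktail n (sval (greedy (height n)))).
  by rewrite [in LHS]e ks_comp.
by move=> <-; apply: (svalP (greedy _)).
Qed.

End PathExistence.

(** * Representations *)

Lemma fct_linE (R : comNzRingType) (U : Type) (V : lmodType R) (c : R)
  (f g : U -> V) (x : U) : (c *: f + g) x = c *: f x + g x.
Proof. by []. Qed.

(** * The algebra of linear operators on a module *)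

Section LinearOperators.
Variables (R : comNzRingType) (V : lmodType R).

(** A submodule of the functions [V -> V], from which [linop] inherits its module structure. *)
Definition is_linop : {pred V -> V} :=
  fun f => `[< forall (c : R) x y, f (c *: x + y) = c *: f x + f y >].

Lemma is_linop_submod : GRing.submod_closed is_linop.
Proof.
split; first by apply/asboolP => c x y; rewrite scaler0 addr0.
move=> a f g /asboolP fL /asboolP gL; apply/asboolP => c x y.
rewrite !fct_linE fL gL !scalerDr !scalerA.
by rewrite [a * c]mulrC -!addrA; congr (_ + _); rewrite addrCA.
Qed.
HB.instance Definition _ :=
  GRing.isSubmodClosed.Build R (V -> V) is_linop is_linop_submod.

Definition linop := {f : V -> V | f \in is_linop}.
HB.instance Definition _ := Choice.on linop.
HB.instance Definition _ := SubChoice.on linop.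
HB.instance Definition _ := [SubChoice_isSubLmodule of linop by <:].

Lemma linopP (f : linop) c x y : val f (c *: x + y) = c *: val f x + val f y.
Proof. by have /asboolP := valP f; apply. Qed.

Lemma linopD (f : linop) x y : val f (x + y) = val f x + val f y.
Proof. by have := linopP f 1 x y; rewrite !scale1r. Qed.

Lemma linop0 (f : linop) : val f 0 = 0.
Proof. by apply: (addrI (val f 0)); rewrite -linopD !addr0. Qed.

Lemma linopZ (f : linop) c x : val f (c *: x) = c *: val f x.
Proof. by have := linopP f c x 0; rewrite linop0 !addr0. Qed.

Lemma linop_comp_subproof (f g : linop) : (val f \o val g) \in is_linop.
Proof. by apply/asboolP => c x y /=; rewrite !linopP. Qed.
Definition linop_comp (f g : linop) : linop :=
  exist _ (val f \o val g) (linop_comp_subproof f g).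

Lemma linop_compA : associative linop_comp.
Proof. by move=> f g h; apply: val_inj. Qed.
Lemma linop_compDl : left_distributive linop_comp +%R.
Proof. by move=> f g h; apply: val_inj. Qed.
Lemma linop_compDr : right_distributive linop_comp +%R.
Proof. by move=> f g h; apply/val_inj/funext => x; apply: linopD. Qed.
Lemma linop_scaleAl (c : R) (f g : linop) :
  c *: linop_comp f g = linop_comp (c *: f) g.
Proof. exact: val_inj. Qed.
Lemma linop_scaleAr (c : R) (f g : linop) :
  c *: linop_comp f g = linop_comp f (c *: g).
Proof. by apply/val_inj/funext => x; apply/esym/linopZ. Qed.

Definition End_nualg : nualg R := NUAlg linop_compA linop_compDl linop_compDr
  linop_scaleAl linop_scaleAr.

End LinearOperators.

(* A set on which the paths act like they do on infinite paths, by prefixing: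
   each point decomposes uniquely as [l y] with [l] of any prescribed degree. *)
Record ksystem k (L : kgraph k) := KSystem {
  kpoint :> Type;
  anchor : kpoint -> kobj L;
  sact : kmor L -> kpoint -> kpoint;
  shead : deg k -> kpoint -> kmor L;
  stail : deg k -> kpoint -> kpoint;
  kd_shead : forall n x, kd (shead n x) = n;
  anchor_stail : forall n x, anchor (stail n x) = ks (shead n x);
  sheadK : forall n x, sact (shead n x) (stail n x) = x;
  anchor_sact : forall l y, ks l = anchor y -> anchor (sact l y) = kr l;
  shead_sact : forall l y, ks l = anchor y -> shead (kd l) (sact l y) = l;
  stail_sact : forall l y, ks l = anchor y -> stail (kd l) (sact l y) = y;
  sact_comp : forall l m y, ks l = kr m -> ks m = anchor y ->
    sact (kcomp l m) y = sact l (sact m y)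
}.

(** * The representation attached to a system, and its kernel *)

Section SystemRep.
Variables (k : nat) (L : kgraph k) (R : comNzRingType).
Variable X : ksystem L.
Implicit Types (l m : kmor L) (v w : kobj L) (x y : X).

Notation V := (X -> R^o).
Notation A := (End_nualg V).

Lemma kr_shead n x : kr (shead n x) = anchor x.
Proof. by rewrite -[in RHS](sheadK n x) anchor_sact ?anchor_stail. Qed.

(** On functions of arbitrary support: restriction to the points anchored at [v], transport along
    [y |-> l y] extended by zero, and pullback along the same map extended by zero. *)
Definition op_p_fun v (f : V) : V := fun x => if anchor x == v then f x else 0.
Definition op_s_fun l (f : V) : V :=
  fun x => if shead (kd l) x == l then f (stail (kd l) x) else 0.
Definition op_g_fun l (f : V) : V :=
  fun x => if anchor x == ks l then f (sact l x) else 0.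

Lemma op_p_linear v : op_p_fun v \in @is_linop R V.
Proof.
apply/asboolP => c f g; apply/funext => x; rewrite /op_p_fun !fct_linE.
by case: ifP; rewrite ?scaler0 ?addr0.
Qed.
Lemma op_s_linear l : op_s_fun l \in @is_linop R V.
Proof.
apply/asboolP => c f g; apply/funext => x; rewrite /op_s_fun !fct_linE.
by case: ifP; rewrite ?scaler0 ?addr0.
Qed.
Lemma op_g_linear l : op_g_fun l \in @is_linop R V.
Proof.
apply/asboolP => c f g; apply/funext => x; rewrite /op_g_fun !fct_linE.
by case: ifP; rewrite ?scaler0 ?addr0.
Qed.

Definition op_p v : A := exist _ (op_p_fun v) (op_p_linear v).
Definition op_s (l : npath L) : A :=
  exist _ (op_s_fun (val l)) (op_s_linear (val l)).
Definition op_g (l : npath L) : A :=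
  exist _ (op_g_fun (val l)) (op_g_linear (val l)).

Lemma linop_ext (a b : A) : (forall f x, val a f x = val b f x) -> a = b.
Proof. by move=> ab; apply: val_inj; apply/funext => f; apply/funext => x. Qed.

Lemma val_linop_mul (a b : A) f : val (a ** b) f = val a (val b f).
Proof. by []. Qed.

Lemma val_linop_sum (I : Type) (s : seq I) (F : I -> A) f x :
  val (\sum_(i <- s) F i) f x = \sum_(i <- s) val (F i) f x.
Proof. by elim/big_rec2: _ => //= i a b _ <-. Qed.

Lemma op_s_comp l m f : ks l = kr m ->
  op_s_fun l (op_s_fun m f) = op_s_fun (kcomp l m) f.
Proof.
move=> lm; apply/funext => x; rewrite /op_s_fun.
(* Either [x] is [l (m y)] and both sides are [f y], or both vanish, since a head [l] followed by a
   head [m] would reassemble to the head [l m]. *)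
have [e|ne] := eqVneq (shead (kd (kcomp l m)) x) (kcomp l m).
  have ex := sheadK (kd (kcomp l m)) x.
  have ax := anchor_stail (kd (kcomp l m)) x.
  rewrite e ks_comp// in ax; rewrite e sact_comp// in ex.
  have alx : ks l = anchor (sact m (stail (kd (kcomp l m)) x)).
    by rewrite anchor_sact.
  move: (stail _ x) ex ax alx => y <- ym ly.
  by rewrite shead_sact// stail_sact// eqxx shead_sact// stail_sact// eqxx.
case: eqP => // el; case: eqP => // em; case/eqP: ne.
rewrite -[x](sheadK (kd l)) el -[stail _ x](sheadK (kd m)) em.
rewrite -sact_comp//; last by rewrite anchor_stail em.
by rewrite shead_sact// ks_comp// anchor_stail em.
Qed.

Lemma op_g_comp l m f : ks l = kr m ->
  op_g_fun m (op_g_fun l f) = op_g_fun (kcomp l m) f.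
Proof.
move=> lm; apply/funext => x; rewrite /op_g_fun ks_comp//.
case: eqP => // xm; rewrite anchor_sact// lm eqxx.
by rewrite sact_comp.
Qed.

Lemma op_family : KP_family op_p op_s op_g.
Proof.
split.
- move=> v w; apply: linop_ext => f x; rewrite val_linop_mul /= /op_p_fun.
  have [<-|vw] := eqVneq v w; first by rewrite /= /op_p_fun; case: eqP.
  by case: eqP => // ->; rewrite (negPf vw).
- move=> l m lm; split=> [n nE||||].
  + split; apply: linop_ext => f x; rewrite val_linop_mul /= nE.
      by rewrite op_s_comp.
    by rewrite op_g_comp.
  + apply: linop_ext => f x; rewrite val_linop_mul /= /op_p_fun /op_s_fun.
    case: eqP => // e1; case: eqP => // e2.
    by case: e1; rewrite -e2 kr_shead.
  + apply: linop_ext => f x; rewrite val_linop_mul /= /op_p_fun /op_s_fun.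
    by case: eqP => // e; rewrite anchor_stail e eqxx.
  + apply: linop_ext => f x; rewrite val_linop_mul /= /op_p_fun /op_g_fun.
    by case: eqP.
  + apply: linop_ext => f x; rewrite val_linop_mul /= /op_p_fun /op_g_fun.
    by case: eqP => // e; rewrite anchor_sact// eqxx.
- move=> l m dlm; apply: linop_ext => f x; rewrite val_linop_mul /= /op_g_fun.
  rewrite /op_s_fun -dlm; have [<-|lm] := eqVneq l m.
    rewrite /= /op_p_fun; case: eqP => // e.
    by rewrite shead_sact// stail_sact// eqxx.
  rewrite /=; case: eqP => // e; rewrite shead_sact// (inj_eq val_inj).
  by rewrite (negPf lm).
- move=> v n e n0 [ue eP]; apply: linop_ext => f x; rewrite val_linop_sum /=.
  rewrite /op_p_fun; have hx : kd (shead n x) != 0 by rewrite kd_shead.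
  (* Only the head of [x] of degree [n] can contribute at [x], and it starts at [v] exactly when [x]
     is anchored there. *)
  pose l0 : npath L := exist _ (shead n x) hx.
  have off (l : npath L) : l \in e -> l != l0 -> val (op_s l ** op_g l) f x = 0.
    move=> /eP[_ dl] ll0; rewrite val_linop_mul /= /op_s_fun dl.
    by case: eqP => // E; case/eqP: ll0; apply: val_inj.
  case: eqP => [ax|xv].
    have l0e : l0 \in e by apply/eP; split; rewrite /= ?kr_shead ?kd_shead.
    rewrite (bigD1_seq l0)// big_seq_cond big1; last first.
      by move=> l /andP[le ll0]; apply: off.
    rewrite [RHS]addr0 /op_s_fun /= /op_g_fun kd_shead eqxx.
    by rewrite anchor_stail eqxx sheadK.
  rewrite big_seq big1 // => l le; apply: off => //; apply/eqP => ll0.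
  by case/eP: le => rl _; apply: xv; rewrite -rl ll0 /= kr_shead.
Qed.

Lemma rep_exists : {f : KP R L -> A |
  [/\ forall (c : R) a b, f (c *: a + b) = c *: f a + f b,
      forall a b, f (a ** b) = f a ** f b &
      [/\ forall v, f (kp_p R v) = op_p v,
          forall l : npath L, f (kp_s R l) = op_s l &
          forall l : npath L, f (kp_g R l) = op_g l]]}.
Proof. by apply: cid; have [f [fP _]] := KP_universal op_family; exists f. Qed.

Definition rep := sval rep_exists.

Lemma repD (a b : KP R L) : rep (a + b) = rep a + rep b.
Proof.
rewrite /rep; case: rep_exists => f [/= fL _ _].
by rewrite -[a]scale1r fL !scale1r.
Qed.

Lemma rep0 : rep 0 = 0.
Proof. by apply: (addrI (rep 0)); rewrite -repD !addr0. Qed.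

Lemma repZ c (a : KP R L) : rep (c *: a) = c *: rep a.
Proof.
rewrite -[c *: a]addr0; move: rep0; rewrite /rep.
by case: rep_exists => f [/= fL _ _] f0; rewrite fL f0 addr0.
Qed.

Lemma repM (a b : KP R L) : rep (a ** b) = rep a ** rep b.
Proof. by rewrite /rep; case: rep_exists => f []. Qed.

Lemma rep_p v : rep (kp_p R v) = op_p v.
Proof. by rewrite /rep; case: rep_exists => f /= [_ _ []]. Qed.

Lemma rep_s (l : npath L) : rep (kp_s R l) = op_s l.
Proof. by rewrite /rep; case: rep_exists => f /= [_ _ []]. Qed.

Lemma shead0 x : shead 0 x = kid (anchor x).
Proof. by rewrite [LHS]kid_eq ?kd_shead// kr_shead. Qed.

(** That identities act trivially is derived here: [x] is the identity applied to [stail 0 x], and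
    the identity is idempotent. *)
Lemma stail0 x : stail 0 x = x.
Proof.
have ax : ks (kid (anchor x)) = anchor (stail 0 x).
  by rewrite anchor_stail shead0.
have ex := sheadK 0 x; rewrite shead0 in ex.
have E : sact (kid (anchor x)) x = x.
  rewrite -{2}ex -sact_comp// ?ks_id ?kr_id//.
  by rewrite -{2}(ks_id (anchor x)) kcomp_idr.
by have := @stail_sact _ _ X (kid (anchor x)) x; rewrite kd_id E ks_id; apply.
Qed.

Lemma rep_spath l f :
  val (rep (spath (@kp_p k R L) (@kp_s k R L) l)) f = op_s_fun l f.
Proof.
case: l / (kpathP l) => [v|n]; last by rewrite spath_val rep_s.
rewrite spath_id rep_p; apply/funext => x.
rewrite /= /op_p_fun /op_s_fun kd_id shead0 stail0.
have -> // : (kid (anchor x) == kid v) = (anchor x == v).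
by apply/eqP/eqP => [/(congr1 (@kr _ _))|->//]; rewrite !kr_id.
Qed.

Definition rep_ker : set (KP R L) := [set a | rep a = 0].

Lemma rep_ker_ideal : nuideal rep_ker.
Proof.
split; rewrite /rep_ker /=.
- exact: rep0.
- by move=> x y x0 y0; rewrite repD x0 y0 addr0.
- by move=> c x x0; rewrite repZ x0 scaler0.
- by move=> a x x0; rewrite !repM x0 numul0l numul0r.
Qed.

(** Applied to the constant function 1 and evaluated at [x], the operator gives [c]. *)
Lemma rep_p_neq0 x c : c != 0 -> ~ rep_ker (c *: kp_p R (anchor x)).
Proof.
move=> c0; rewrite /rep_ker /= repZ rep_p.
move=> /(congr1 (fun a : A => val a (fun=> 1) x)).
rewrite /= {1}/GRing.scale/= {1}/GRing.scale/= /op_p_fun eqxx => /eqP.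
by rewrite /GRing.scale/= mulr1 (negPf c0).
Qed.

Lemma rep_p_eq0 v : (forall x, anchor x <> v) -> rep_ker (kp_p R v).
Proof.
move=> hv; rewrite /rep_ker /= rep_p; apply: linop_ext => f x /=.
by rewrite /op_p_fun; case: eqP => // /hv.
Qed.

(** If a nonzero multiple of [p_v] acts as zero, no point is anchored at [v], so [p_v] itself acts
    as zero. *)
Lemma rep_ker_basic : basic_ideal rep_ker.
Proof.
split=> [|v c c0 cv]; first exact: rep_ker_ideal.
by apply: rep_p_eq0 => x xv; apply: (@rep_p_neq0 x c c0); rewrite xv.
Qed.

End SystemRep.
Arguments rep_ker {k L} R X.
Arguments rep {k L R} X.

(** * Simplicity *)

Section Systems.
Variables (k : nat) (L : kgraph k).

Definition ipath_system : ksystem L :=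
  @KSystem k L (ipath L) (@irange k L) (@icons k L) (fun n x => x n)
    (@ishift k L) (fun n x => kd_iseg x n) (@irange_ishift k L)
    (@icons_ishift k L) (@irange_icons k L) (@icons_kd k L)
    (@ishift_icons k L) (@icons_comp k L).

Section Subsystem.
Variables (X : ksystem L) (Q : X -> Prop).
Hypothesis Qact : forall l y, ks l = anchor y -> Q y -> Q (sact l y).
Hypothesis Qtail : forall n x, Q x -> Q (stail n x).

Let Y := {x : X | Q x}.

Definition sub_act l (y : Y) : Y :=
  if pselect (ks l = anchor (sval y)) is left e
  then exist _ _ (Qact e (svalP y)) else y.

Definition sub_tail n (y : Y) : Y := exist _ _ (Qtail n (svalP y)).

Lemma sub_actE l (y : Y) : ks l = anchor (sval y) ->
  sval (sub_act l y) = sact l (sval y).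
Proof. by move=> e; rewrite /sub_act; case: pselect. Qed.

Lemma sub_eq (x y : Y) : sval x = sval y -> x = y.
Proof. by case: x y => [x Qx] [y Qy] /= xy; apply: eq_exist. Qed.

Definition sub_system : ksystem L.
Proof.
apply: (@KSystem k L Y (fun y => anchor (sval y)) sub_act
  (fun n y => shead n (sval y)) sub_tail).
- by move=> n x; apply: kd_shead.
- by move=> n x; apply: anchor_stail.
- by move=> n x; apply: sub_eq; rewrite sub_actE/= ?sheadK ?anchor_stail.
- by move=> l y ly; rewrite sub_actE// anchor_sact.
- by move=> l y ly; rewrite sub_actE// shead_sact.
- by move=> l y ly; apply: sub_eq; rewrite /= sub_actE// stail_sact.
- move=> l m y lm my; apply: sub_eq.
  by rewrite !sub_actE ?ks_comp// ?anchor_sact// sact_comp.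
Defined.

End Subsystem.

(* Recording one coordinate of the degree makes the action separate paths of
   different degrees. *)
Definition graded_system (X : ksystem L) (i : 'I_k) : ksystem L.
Proof.
apply: (@KSystem k L (X * int)%type (fun y => anchor y.1)
  (fun l y => (sact l y.1, y.2 + (kd l i)%:Z)) (fun n y => shead n y.1)
  (fun n y => (stail n y.1, y.2 - (n i)%:Z))).
- by move=> n x; apply: kd_shead.
- by move=> n x; apply: anchor_stail.
- by move=> n [x g]; rewrite /= sheadK kd_shead subrK.
- by move=> l y ly; apply: anchor_sact.
- by move=> l y ly; apply: shead_sact.
- by move=> l [x g] ly; rewrite /= stail_sact// addrK.
- move=> l m [x g] lm my /=; rewrite sact_comp// kd_comp// ffunE -addrA.
  by rewrite [(kd m i)%:Z + _]addrC -PoszD.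
Defined.

End Systems.

(** * Basic simplicity versus cofinality and aperiodicity *)

Section Simplicity.
Variables (k : nat) (hk : (0 < k)%N) (L : kgraph k).
Variables (hfin : row_finite L) (hsrc : no_sources L) (R : comNzRingType).
Implicit Types (l : kmor L) (v w : kobj L).

Local Notation p := (@kp_p k R L).
Local Notation s := (spath (@kp_p k R L) (@kp_s k R L)).

Lemma ipath_exists v : exists x : ipath L, irange x = v.
Proof.
have next w : True ->
    {l : kmor L | [/\ kr l = w, kd l = [ffun=> 1%N] & True]}.
  by move=> _; apply: cid; have [l [rl dl]] := hsrc w [ffun=> 1%N]; exists l.
exists (greedy_path (Q := fun=> True) next (v := v) I); exact: irange_greedy.
Qed.

Lemma kp_p_neq0 v : p v <> 0.
Proof.
have [x <-] := ipath_exists v.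
move=> p0; apply: (@rep_p_neq0 _ _ R (ipath_system L) x 1); rewrite ?oner_eq0//.
by rewrite /rep_ker/= [p _]p0 scaler0 rep0.
Qed.

(** The point [x] keeps the basic ideal [rep_ker R X] from being the whole algebra. *)
Lemma rep_ker_trivial (X : ksystem L) (x : X) : basically_simple R L ->
  rep_ker R X = [set 0]%classic.
Proof.
move=> simp; have [//|kT] := simp _ (@rep_ker_basic k L R X).
case: (@rep_p_neq0 k L R X x 1); first by rewrite oner_eq0.
by rewrite kT.
Qed.

Lemma basically_simple_cofinal : basically_simple R L -> cofinal L.
Proof.
move=> simp f v; apply: contrapT => noconn.
pose x := hom_ipath f.
(* Asking this of every vertex of [y], and not only of its range, makes [Q] stable under tails. *)
pose Q (y : ipath_system L) :=
  forall n, exists m, exists2 l, kr l = ks ((y : ipath L) n) & ks l = ks (x m).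
have Qact l (y : ipath_system L) : ks l = anchor y -> Q y -> Q (sact l y).
  move=> ly Qy n; have [m [l' rl' sl']] := Qy n; exists m.
  (* The vertex of [l y] at [n] leads to its vertex at [kd l + n], which is the vertex of [y] at
     [n]. *)
  have ln : deg_le n (kd l + n) by rewrite addrC deg_le_addr.
  have [b sb] := iseg_prefix (icons l y) ln; rewrite icons_add// => E.
  have sbl' : ks b = kr l'.
    rewrite rl'; have := congr1 (@ks _ _) E; rewrite !ks_comp//.
    by rewrite kr_iseg.
  by exists (kcomp b l'); rewrite ?kr_comp ?ks_comp.
have Qtail q (y : ipath_system L) : Q y -> Q (stail q y).
  move=> Qy n; have [m [l' rl' sl']] := Qy (q + n); exists m; exists l' => //=.
  by have [sq e _] := iseg_ktail q y n; rewrite rl' [in LHS]e ks_comp.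
have Qx : Q x.
  by move=> n; exists n; exists (kid (ks (x n))); rewrite ?kr_id ?ks_id.
pose y0 : sub_system Qact Qtail := exist _ (x : ipath_system L) Qx.
have ker0 := rep_ker_trivial y0 simp.
apply: (@kp_p_neq0 v); have : rep_ker R (sub_system Qact Qtail) (p v).
  apply: rep_p_eq0 => -[y Qy] /= yv; apply: noconn.
  have [m [l rl sl]] := Qy 0; exists m, l; split.
    by rewrite rl iseg0 ks_id.
  by rewrite sl ks_hom_ipath.
by rewrite ker0.
Qed.

Lemma basically_simple_aperiodic : basically_simple R L -> aperiodic L.
Proof.
move=> simp v m n mn; apply: contrapT => per.
(* A path [al] of degree [M] is cut at [m] and at [n], giving [al = a a' = b b']. *)
pose M := deg_max m n; have [al [ral dal]] := hsrc v M.
have mM : deg_le m (kd al) by rewrite dal deg_maxl.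
have nM : deg_le n (kd al) by rewrite dal deg_maxr.
have [da sa ea] := kheadtailP mM; have [db sb eb] := kheadtailP nM.
move: da sa ea db sb eb; set a := khead m al; set a' := ktail m al.
set b := khead n al; set b' := ktail n al => da sa ea db sb eb.
have sa' : ks a' = ks al by rewrite ea ks_comp.
have sb' : ks b' = ks al by rewrite eb ks_comp.
(* The segments of [al z(0, q)] of degree [q] starting at [m] and at [n] are the initial segments of
   [a' z] and [b' z]; the failure of aperiodicity equates them. *)
have eq_cons (z : ipath L) : irange z = ks al -> icons a' z = icons b' z.
  move=> rz; apply: ipathP => q.
  have alz : ks al = kr (z q) by rewrite kr_iseg.
  have ez : deg_sub (kd (kcomp al (z q))) M = q.
    by rewrite kd_comp// dal kd_iseg deg_addK.
  have seg (c c' : kmor L) d : kd c = d -> ks c = kr c' -> al = kcomp c c' ->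
      segment (kcomp al (z q)) d (d + q) = icons c' z q.
    move=> dc cc' E; have sc' : ks c' = irange z by rewrite rz E ks_comp.
    have c'z : deg_le q (kd (kcomp c' (z q))) by apply: icons_le.
    rewrite iconsE//; have [dh sh eh] := kheadtailP c'z.
    have hc : ks c = kr (khead q (kcomp c' (z q))).
      by rewrite cc' kr_khead// kr_comp ?kr_iseg.
    have -> : kcomp al (z q) = kcomp c (kcomp c' (z q)).
      by rewrite E kcompA ?kr_iseg.
    by rewrite [in LHS]eh; have := segmentE hc sh; rewrite dc dh.
  apply: contrapT => neq; apply: per; exists (kcomp al (z q)).
  split; rewrite ?kr_comp//; first by rewrite kd_comp// dal deg_le_addr.
  by rewrite ez (seg _ _ _ da sa ea) (seg _ _ _ db sb eb).
have dab : kd a' <> kd b'.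
  move=> dab; apply: mn; rewrite -da -db.
  have := kd_comp sa; rewrite -ea eb kd_comp// dab ![_ + kd b']addrC.
  by move=> /deg_addI.
have [z rz] := ipath_exists (ks al).
(* If [x] starts with [c], then [x = c y = d y] for one and the same [y], and both operators return
   [f y]. *)
have op_s_fun_eq (c d : kmor L) (f : ipath_system L -> R^o) (x : ipath L) :
    ks c = ks al -> ks d = ks al ->
    (forall y, irange y = ks al -> icons c y = icons d y) ->
    x (kd c) = c -> op_s_fun c f x = op_s_fun d f x.
  move=> sc sd cd xc; rewrite /op_s_fun /= xc eqxx.
  have rx : irange (ishift (kd c) x) = ks al by rewrite irange_ishift xc.
  have ex : x = icons d (ishift (kd c) x).
    by rewrite -cd//; have := icons_ishift (kd c) x; rewrite xc.
  have exd : x (kd d) = d by rewrite {1}ex icons_kd ?rx.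
  by rewrite exd eqxx {2}ex ishift_icons ?rx.
have ker0 := @rep_ker_trivial (ipath_system L) z simp.
have : rep_ker R (ipath_system L) (s a' + -1 *: s b').
  rewrite /rep_ker /= repD repZ scaleN1r.
  suff -> : rep (ipath_system L) (s a') = rep (ipath_system L) (s b').
    exact: subrr.
  apply: linop_ext => f x; rewrite !rep_spath.
  have [xa|xa] := eqVneq ((x : ipath L) (kd a')) a'.
    exact: op_s_fun_eq xa.
  have [xb|xb] := eqVneq ((x : ipath L) (kd b')) b'.
    by apply/esym/op_s_fun_eq => // y ry; rewrite eq_cons.
  by rewrite /op_s_fun /= (negPf xa) (negPf xb).
rewrite ker0 /= scaleN1r => /subr0_eq eq_s.
have [i di] : exists i, kd a' i != kd b' i.
  apply: contrapT => /forallNP h; apply: dab; apply/ffunP => i.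
  by apply/eqP; apply: contrapT => /negP /h.
pose G := graded_system (ipath_system L) i.
(* At [x0 = a' (z, 0)] the operator of [a'] reads [f] in grade 0 and gives 1; that of [b'] gives 0,
   either off its image or by reading [f] in the nonzero grade [kd a' i - kd b' i]. *)
pose f : G -> R^o := fun x => if x.2 == 0 then 1 else 0.
pose x0 : G := sact a' ((z, 0) : G).
have : val (rep G (s a')) f x0 = val (rep G (s b')) f x0 by rewrite eq_s.
rewrite !rep_spath /op_s_fun shead_sact ?stail_sact /= ?sa' ?rz// eqxx.
rewrite /f /= add0r subr_eq0 eqz_nat (negPf di).
by case: ifP => _ /eqP; rewrite oner_eq0.
Qed.

Lemma cofinal_aperiodic_basically_simple : cofinal L -> aperiodic L ->
  basically_simple R L.
Proof.
move=> cof ap J [idJ basJ].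
have [[x Jx x0]|J0] := pselect (exists2 x, J x & x <> 0); last first.
  left; apply/seteqP; split => [x Jx|_ ->]; last by case: idJ.
  by apply: contrapT => x0; apply: J0; exists x.
right; have [v [c [c0 Jc]]] := aperiodic_vertex hk hfin hsrc ap idJ Jx x0.
have {c c0 Jc} Jv := basJ v c c0 Jc.
apply: (ideal_total hk hfin hsrc idJ) => w; apply: contrapT => Jw.
(* Contrapositive of saturation: a vertex outside [J] has a path of degree (1,...,1) to another
   one. *)
have next u : ~ J (p u) ->
    {l : kmor L | [/\ kr l = u, kd l = [ffun=> 1%N] & ~ J (p (ks l))]}.
  move=> Ju; apply: cid; apply: contrapT => nol; apply: Ju.
  apply: (ideal_saturated hk hfin hsrc (n := [ffun=> 1%N])) idJ _ => l rl dl.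
  by apply: contrapT => Jl; apply: nol; exists l.
pose y := greedy_path (Q := fun u => ~ J (p u)) next Jw.
(* Heredity along [l] puts the vertex of [y] at [n] in [J], whereas that vertex leads to one outside
   [J]. *)
have [n [l [rl sl]]] := cof (omega_path y) v.
have [l' sl' Jl'] := greedy_pathP next Jw n.
apply: Jl'; apply: ideal_hereditary => //; rewrite -sl'.
by have := ideal_hereditary hk hsrc (l := l) idJ; rewrite rl sl; apply.
Qed.

End Simplicity.

Theorem theorem5p14 (k : nat) (hk : (0 < k)%N) (L : kgraph k)
    (hfin : row_finite L) (hsrc : no_sources L) (R : comNzRingType) :
  basically_simple R L <-> cofinal L /\ aperiodic L.
Proof.
split=> [simp|[cof ap]]; last exact: cofinal_aperiodic_basically_simple.
split; first exact: basically_simple_cofinal simp.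
exact: basically_simple_aperiodic simp.
Qed.
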